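(* For every $n\geq 2$, every $p\in\{1,\ldots,n-1\}$ and every $\nu\in[0,1]$, $$\lambda_{p,\nu}(n)\geq\frac{\nu(1-\nu)(\nu^p+(1-\nu)^p)}{(n+1)!}\left[\left(h_p^n+2^{p-1}\sum_{i=0}^{p-1}\frac{h_i^n}{2^i}\right)\binom{n}{p+1}+\sum_{j=p+1}^{n+1}\left(h_j^n+2^{j-2}\sum_{i=0}^{j-2}\frac{h_i^n}{2^i}\right)\binom{n+p-j}{p+1}\right].$$
   Context: Binomial coefficients $\binom{a}{b}$ with $0\leq a<b$ are zero. $\Delta_n$ is the standard $n$-simplex, $\mathrm{Sd}^d(K)$ the $d$-th iterated barycentric subdivision of $K$, $f_i(L)$ the number of $i$-simplices of $L$, $b_i(L)=\dim H_i(L;\mathbb{Z}/2\mathbb{Z})$. Definition of $\lambda_{p,\nu}(n)$. For a finite simplicial complex $L$, $$M_{p,\nu}(L)=(\nu^{p+1}+(1-\nu)^{p+1})\,b_p(L)+\nu(1-\nu)(\nu^p+(1-\nu)^p)\sum_{i=p+1}^{\dim L}(-1)^{i+1-p}(f_i(L)-b_i(L)),$$ the sum being zero if $p\geq\dim L$. For $d>0$, $\mathcal{L}_d^{n,p}$ is the finite set of subcomplexes $L$ of $\mathrm{Sd}^d(\Delta_n)$ containing a family of simplices $\{\sigma_i\in L,\ i\in I\}$ such that (1) every $\tau\in L$ is a face of some $\sigma_i$; (2) $\dim(\sigma_i\cap\sigma_j)<p-1$ for all $i\neq j$ in $I$; (3) $\dim(\sigma_i\cap\mathrm{Sd}^d(\partial\Delta_n))<p-1$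 for all $i\in I$ (with $\dim\emptyset=-1$). Set $\lambda^d_{p,\nu}(n)=\frac{1}{(n+1)!^d}\max_{L\in\mathcal{L}_d^{n,p}}M_{p,\nu}(L)$; this sequence is non-decreasing and bounded in $d$ and $\lambda_{p,\nu}(n)=\lim_{d\to+\infty}\lambda^d_{p,\nu}(n)$. Definition of $h^n$. For $s\in\{0,\ldots,n+1\}$, $T_s^n=\Delta_n\setminus(\sigma_1\cup\cdots\cup\sigma_s)$ is the closed $n$-simplex deprived of $s$ of its facets and $\mathrm{Sd}(T_s^n)=\mathrm{Sd}(\Delta_n)\setminus\bigcup_{i=1}^s\mathrm{Sd}(\sigma_i)$. A tiling of $\mathrm{Sd}(T_s^n)$ is a partition into tiles, each being an $n$-simplex of $\mathrm{Sd}(\Delta_n)$ deprived of $t$ of its facets for some $t$ (type $T_t^n$); its $h$-vector $(h_0,\ldots,h_{n+1})$ counts the tiles of each type. $H_n$ is the $(n+2)\times(n+2)$ matrix whose $(s+1)$-st row is the $h$-vector of a tiling of $\mathrm{Sd}(T_s^n)$ containing exactly one tile $T_0^n$ if $s=0$ and none if $s>0$ (such tilings exist and the $h$-vector does not depend on the choice). Equivalently, $H_0=\mathrm{Id}_2$ and, for $n\geq 0$ and $s\in\{1,\ldots,n+3\}$, the $s$-th row of $H_{n+1}$ is the sum of the first $s-1$ rows of $H_n$ each preceded by a $0$ and of the last $n+3-s$ rows of $H_n$ each followed by a $0$. $h^n=(h_0^n,\ldots,h_{n+1}^n)$ is the eigenvector of the transposed matrix $H_n^t$ associated to the (simple) eigenvalue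 $(n+1)!$, normalized by $\sum_{s=0}^{n+1}h_s^n=1$. *)

(* Defs.v *)
From HB Require Import structures.
From mathcomp Require Import all_boot all_order all_algebra.

Set Implicit Arguments.
Unset Strict Implicit.
Unset Printing Implicit Defensive.

Import Order.TTheory GRing.Theory Num.Theory.
Local Open Scope ring_scope.

Section Complexes.
Variable V : finType.
Implicit Types (K L F : {set {set V}}) (s t A : {set V}).

(* Finite abstract simplicial complexes, as sets of nonempty simplices; the
   empty complex is allowed. *)
Definition is_complex K : bool :=
  [forall s in K, (s != set0) && [forall t, (t != set0) && (t \subset s) ==> (t \in K)]].

Definition subcomplex L K : bool := is_complex L && (L \subset K).

Definition full_complex A : {set {set V}} := [set s | (s != set0) && (s \subset A)].

(* csize K = dim K + 1. *)
Definition csize K : nat := \max_(s in K) #|s|.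
(* dim(emptyset) = -1, for simplices and for complexes. *)
Definition sdim s : int := #|s|%:Z - 1.
Definition cdim K : int := (csize K)%:Z - 1.

Definition simplices K (i : nat) : {set {set V}} := [set s in K | #|s| == i.+1].
Definition fnum K (i : nat) : nat := #|simplices K i|.

(* Simplicial chains over Z/2, as row vectors: [bdry K i] is the matrix of the
   boundary map C_(i+1) -> C_i, acting on the right. *)
Definition bdry K (i : nat) : 'M['F_2]_(#|simplices K i.+1|, #|simplices K i|) :=
  \matrix_(a < #|simplices K i.+1|, b < #|simplices K i|)
    ((enum_val b : {set V}) \subset (enum_val a : {set V}))%:R.

Definition cycles K (i : nat) : 'M['F_2]_(#|simplices K i|) :=
  match i with
  | 0 => 1%:M
  | i'.+1 => kermx (bdry K i')
  end.

(* [A :\: B] is a complement of B in A when B <= A, so this is the dimension of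
   the quotient (unreduced homology). *)
Definition betti K (i : nat) : nat := \rank (cycles K i :\: bdry K i)%MS.

(* First barycentric subdivision: the nonempty chains of simplices of K. *)
Definition sd K : {set {set {set V}}} :=
  [set c : {set {set V}} | [&& c != set0, c \subset K &
     [forall s in c, forall t in c, (s \subset t) || (t \subset s)]]].

Definition facets s : {set {set V}} := [set s :\ v | v in s].

(* The (open) faces of the simplex s that remain once the facets in F are
   removed. *)
Definition tile_support (x : {set V} * {set {set V}}) : {set {set V}} :=
  full_complex x.1 :\: \bigcup_(f in x.2) full_complex f.

End Complexes.

Fixpoint sdV (V : finType) (d : nat) : finType :=
  match d with
  | 0 => V
  | d'.+1 => {set sdV V d'}
  end.

Fixpoint iter_sd (V : finType) (d : nat) (K : {set {set V}}) : {set {set sdV V d}} :=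
  match d return {set {set sdV V d}} with
  | 0 => K
  | d'.+1 => sd (iter_sd d' K)
  end.

Definition Delta (n : nat) : {set {set 'I_n.+1}} := full_complex [set: 'I_n.+1].
Definition dDelta (n : nat) : {set {set 'I_n.+1}} := Delta n :\ [set: 'I_n.+1].

(* The packings L of Sd^d(Delta_n). The intersection of a simplex s with a
   subcomplex K is the complex of those simplices of K that are faces of s. *)
Definition packing (d n p : nat) : {set {set {set sdV 'I_n.+1 d}}} :=
  [set L | subcomplex L (iter_sd d (Delta n)) &&
   [exists F : {set {set sdV 'I_n.+1 d}},
     [&& F \subset L,
         [forall t in L, exists s in F, t \subset s],
         [forall s in F, forall t in F, (s != t) ==> (sdim (s :&: t) < p%:Z - 1)] &
         [forall s in F,
            cdim [set t in iter_sd d (dDelta n) | t \subset s] < p%:Z - 1]]]].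

Definition Mfun (R : realFieldType) (V : finType) (p : nat) (nu : R)
    (L : {set {set V}}) : R :=
  (nu ^+ p.+1 + (1 - nu) ^+ p.+1) * (betti L p)%:R
  + nu * (1 - nu) * (nu ^+ p + (1 - nu) ^+ p) *
    \sum_(p.+1 <= i < csize L)
       (-1) ^+ (i.+1 - p) * ((fnum L i)%:R - (betti L i)%:R).

(* The default value of the maximum is attained, the empty complex being a
   packing. *)
Definition lambda_seq (R : realFieldType) (n p : nat) (nu : R) (d : nat) : R :=
  ((n.+1)`!%:R ^+ d)^-1 *
  \big[Num.max/Mfun p nu (set0 : {set {set sdV 'I_n.+1 d}})]_(L in packing d n p)
     Mfun p nu L.

(* Sd(T_s^n): the s facets removed are those opposite to the vertices
   0, .., s-1. *)
Definition sdT (n s : nat) : {set {set {set 'I_n.+1}}} :=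
  sd (Delta n) :\: \bigcup_(i : 'I_n.+1 | (i < s)%N) sd (full_complex [set~ i]).

Section Tilings.
Variable n : nat.

(* A tile is an n-simplex of Sd(Delta_n) together with its removed facets. *)
Local Notation tile := ({set {set 'I_n.+1}} * {set {set {set 'I_n.+1}}})%type.
Implicit Types T : {set tile}.

Definition is_tiling (s : nat) T : bool :=
  [&& [forall x in T, [&& x.1 \in sd (Delta n), #|x.1| == n.+1 & x.2 \subset facets x.1]],
      [forall x in T, tile_support x \subset sdT n s] &
      [forall t in sdT n s, #|[set x in T | t \in tile_support x]| == 1%N]].

(* Number of tiles of type T_t^n. *)
Definition hcount T (t : nat) : nat := #|[set x in T | #|x.2| == t]|.

(* A chosen tiling of Sd(T_s^n) with exactly one tile T_0^n if s = 0 and none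
   otherwise. Such tilings exist, and they all have the same h-vector. *)
Definition the_tiling (s : nat) : {set tile} :=
  odflt set0 [pick T | is_tiling s T && (hcount T 0 == (s == 0%N))].

End Tilings.

Definition Hmx (R : realFieldType) (n : nat) : 'M[R]_n.+2 :=
  \matrix_(s, t) (hcount (the_tiling n s) t)%:R.

(* Imported only here because the names of classical_sets shadow finset's. *)
From mathcomp Require Import all_classical all_reals all_analysis.
Import numFieldNormedType.Exports.

Definition lambda (R : realType) (n p : nat) (nu : R) : R :=
  limn (lambda_seq n p nu).

Definition hvec (R : realType) (n : nat) : 'cV[R]_n.+2 :=
  xget 0 [set h : 'cV[R]_n.+2 |
    (Hmx R n)^T *m h = (n.+1)`!%:R *: h /\ \sum_s h s 0 = 1]%classic.

(* Only used for s <= n + 1. *)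
Definition hcoef (R : realType) (n s : nat) : R := hvec R n (inord s) 0.

(* Main.v *)
Require Import Defs.
From HB Require Import structures.
From mathcomp Require Import all_boot all_order all_algebra all_fingroup.
From mathcomp Require Import zify ring.

Set Implicit Arguments.
Unset Strict Implicit.
Unset Printing Implicit Defensive.

Import Order.TTheory GRing.Theory Num.Theory.

(** Fix p and call weight of a family of simplices the sum of the binomials
    C(dim s, p + 1) over its members s.

    Value of a packing. If the members of a family share pairwise fewer than p
    vertices, then each simplex with at least p vertices of the complex L that
    they span lies in exactly one member. Hence a cycle of degree at least p can
    be filled by coning each of its simplices from a vertex of that member, so
    that the Betti numbers of L vanish from degree p on [betti_packed], and the
    faces of L of dimension at least p are counted member by member. Alternating
    sums of binomials then collapse and M(L) is
    c = nu (1 - nu) (nu^p + (1 - nu)^p) times the weight [Mfun_packed]. Up to the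
    factor c / (n+1)!^d, the number lambda^d is thus the largest weight of a
    family of simplices of Sd^d(Delta_n) that pairwise share fewer than p
    vertices and whose faces with at least p vertices are interior to Delta_n.
    For T_s in place of the open simplex, these families are called
    [admissible].

    Self-similarity. Each n-simplex of Sd(Delta_n) contains a copy of
    Sd^d(Delta_n) inside Sd^(d+1)(Delta_n). Put into each tile of a tiling of
    Sd(T_s) a copy of a family admissible for the type of that tile. As the tiles
    are disjoint, no simplex with p vertices is shared by two copies, so the
    union is admissible for T_s, and the weights add up [admissible_assemble].
    Applied to all open n-simplices, this shows that lambda^d is nondecreasing;
    counting the simplices of Sd^d(Delta_n) shows that it is bounded. Applied to
    tilings with h-vectors the rows of H, it shows that if w(s) is reached by T_s
    in the first subdivision, then (H^k w)(s) is reached in the (k+1)-st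
    [iter_weight_admissible].

    First subdivision. For each word U, a set of vertices that contains the
    vertices 0, .., s - 1 and not the last one, consider the permutation that
    lists U increasingly, then the last vertex, then the complement of U
    decreasingly, and the flag of its initial segments. If q belongs to U and
    not to U', then the flags of U and U' share only faces whose index in U' is
    at most q; dropping some faces of the flags makes all the intersections smaller than p
    [word_chain_inter], and the resulting family for T_s has weight at least the
    coefficient w(s) of h_s in the bracket of the theorem [tile_weight_leq].

    Passage to the limit. A tiling of Sd(T_s) has N = (n+1)! tiles, at least one
    of them of type T_1, as a count of vertices shows [card_tiling,
    hcount1_gt0]. Therefore H / N is a stochastic matrix with a positive column,
    and applying H to a vector multiplies its oscillation by at most N - 1: the
    entries of H^k w / N^k differ from each other by O((1 - 1/N)^k). As h is a
    left eigenvector of H for N with sum 1, the number h.w = h.(H^k w) / N^k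
    differs by so much from the last entry of H^k w / N^k, which is at most
    N lambda / c [eigen_weight_bound]. The tilings that give H exist
    [perm_tilingP]: group the chains according to the flag obtained by filling
    each of their gaps decreasingly. *)

(** * Homology and value of a packed complex *)

Section PackedComplexes.
Variables (V : finType) (p : nat).
Implicit Types (L F : {set {set V}}) (r s t : {set V}).

Definition weight F : nat := \sum_(s in F) 'C(#|s|.-1, p.+1).

Definition packed_by L F : Prop :=
  [/\ is_complex L, F \subset L,
      forall t, t \in L -> exists2 s, s \in F & t \subset s &
      {in F &, forall s t, s != t -> #|s :&: t| < p}].

Lemma complexP (K : {set {set V}}) : reflect ((forall s, s \in K -> s != set0) /\
   (forall s t, s \in K -> t != set0 -> t \subset s -> t \in K)) (@is_complex V K).
Proof.
apply: (iffP idP) => [/'forall_implyP H | [H1 H2]].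
  split=> [s /H /andP[] // | s t /H /andP[_ /forallP/(_ t)] /implyP Ht t0 ts].
  by apply: Ht; rewrite t0.
apply/'forall_implyP => s sK; rewrite H1 //=.
by apply/forallP => t; apply/implyP => /andP[t0 ts]; apply: H2 ts.
Qed.

Section Packed.
Variables (L F : {set {set V}}).
Hypothesis (p_gt0 : 0 < p) (LF : packed_by L F).

Lemma packed_uniq t s1 s2 : p <= #|t| -> s1 \in F -> s2 \in F ->
  t \subset s1 -> t \subset s2 -> s1 = s2.
Proof.
case: LF => _ _ _ H pt s1F s2F ts1 ts2; apply/eqP; apply: contraLR pt => ne.
rewrite -ltnNge; apply: leq_ltn_trans (H _ _ s1F s2F ne).
by apply: subset_leq_card; rewrite subsetI ts1.
Qed.

Lemma sum_enum_val (A : {set {set V}}) (G : {set V} -> 'F_2) :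
  (\sum_(a < #|A|) G (enum_val a) = \sum_(t in A) G t)%R.
Proof. by rewrite [RHS]big_enum_val. Qed.

(** The cone of a simplex t is taken from a vertex of the unique member of F
    that contains t. On simplices with more than p vertices this vertex does not
    change along faces, so the cone operator is a contracting homotopy there. *)
Lemma betti_packed i : p <= i -> betti L i = 0.
Proof.
case: i => [|i] pi; first by rewrite leqn0 in pi; move: p_gt0; rewrite (eqP pi).
have [/complexP[Ln0 Ldn] FL LFs _] := LF.
suff sub : (kermx (bdry L i) <= bdry L i.+1)%MS.
  rewrite /betti /cycles; apply/eqP.
  have := mxrank_cap_compl (kermx (bdry L i)) (bdry L i.+1).
  by rewrite (capmx_idPl sub) => /eqP; rewrite -{2}[\rank _]addn0 eqn_add2l.
apply/rV_subP => u /sub_kermxP u0.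
have [x0 _|noV] := pickP (fun _ : V => true); last first.
  suff -> : u = 0%R by rewrite sub0mx.
  apply/rowP => a; have := enum_valP a; rewrite inE => /andP[/Ln0 /set0Pn [x _] _].
  by have := noV x.
pose sg t := odflt set0 [pick s in F | t \subset s].
pose ct s := odflt x0 [pick y in s].
have sgP t : t \in L -> sg t \in F /\ t \subset sg t.
  move=> /LFs[s sF ts]; rewrite /sg; case: pickP => [s' /andP[] // | /(_ s)].
  by rewrite sF ts.
have ctP s : s != set0 -> ct s \in s.
  by case/set0Pn => y ys; rewrite /ct; case: pickP => // /(_ y); rewrite ys.
have sgE t s : t \in L -> p <= #|t| -> s \in F -> t \subset s -> sg t = s.
  by move=> /sgP[? ?] pt sF ts; apply: packed_uniq pt _ _ _ _.
pose uf t : 'F_2 := (\sum_(a | enum_val a == t) u 0 a)%R.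
have ufE a : uf (enum_val a) = u 0%R a.
  by rewrite /uf (big_pred1 a) // => b /=; rewrite (inj_eq enum_val_inj).
have cyc r : r \in simplices L i ->
    (\sum_(t in simplices L i.+1 | r \subset t) uf t = 0)%R.
  move=> rL; have := congr1 (fun M : 'rV_ _ => M 0%R (enum_rank_in rL r)) u0.
  rewrite !mxE => E; rewrite -[RHS]E big_mkcondr -sum_enum_val /=.
  apply: eq_bigr => a _; rewrite !mxE enum_rankK_in // ufE.
  by case: ifP => _; rewrite ?mulr1 ?mulr0.
(* The cone over u. *)
pose vf t := (if ct (sg t) \in t then uf (t :\ ct (sg t)) else 0)%R.
apply/submxP; exists (\row_a vf (enum_val a))%R; apply/rowP => b; rewrite !mxE.
have := enum_valP b; rewrite -ufE; under [X in _ -> _ = X]eq_bigr do rewrite !mxE.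
move: (enum_val b) => t.
rewrite inE => /andP[tL /eqP ct2].
transitivity (\sum_(t' in simplices L i.+2 | t \subset t') vf t')%R; last first.
  rewrite big_mkcondr -sum_enum_val /=; apply: eq_bigr => a _.
  by case: ifP => _; rewrite ?mulr1 ?mulr0.
have pt : p <= #|t| by rewrite ct2; apply: leq_trans pi _.
have [sF ts] := sgP _ tL.
have := ctP (sg t) _; have -> : sg t != set0 by apply: Ln0; apply: (subsetP FL).
move/(_ isT); set s := sg t in sF ts *; set v := ct s => vs.
have sL : s \in L by apply: (subsetP FL).
have sgt t' : t \subset t' -> t' \in L -> sg t' = s.
  move=> tt' t'L; have [s'F t's'] := sgP _ t'L.
  by rewrite /s (sgE t (sg t')) //; apply: subset_trans tt' _.
have -> : (\sum_(t' in simplices L i.+2 | t \subset t') vf t' =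
           \sum_(t' in simplices L i.+2 | (t \subset t') && (v \in t')) uf (t' :\ v))%R.
  rewrite !big_mkcondr /=; apply: eq_bigr => t'; rewrite inE => /andP[t'L _].
  by case: ifP => //= tt'; rewrite /vf sgt.
(* If v is not in t, the only term is the cone v |: t over t itself. Otherwise
   the terms are, after removal of v, those of the boundary of u at t :\ v
   other than u t, and this boundary vanishes. *)
have [vt|vt] := boolP (v \in t); last first.
  rewrite (big_pred1 (v |: t)) => [|t' /=]; first by rewrite setU1K.
  rewrite inE; apply/idP/eqP => [/andP[/andP[t'L /eqP ct'] /andP[tt' vt']] | ->].
    apply/esym/eqP; rewrite eqEcard subUset sub1set vt' tt' /= ct' cardsU1 vt.
    by rewrite ct2.
  rewrite cardsU1 vt ct2 eqxx subsetU1 setU11 !andbT.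
  apply: (Ldn s) => //; first by apply/set0Pn; exists v; rewrite setU11.
  by rewrite subUset sub1set vs.
have ctv : #|t :\ v| = i.+1 by move: ct2; rewrite (cardsD1 v) vt => -[].
have tvL : t :\ v \in L.
  by apply: (Ldn t); rewrite ?subD1set // -card_gt0 ctv.
have := cyc (t :\ v); rewrite inE tvL ctv eqxx => /(_ isT).
rewrite (bigD1 t) /= ?inE ?tL ?ct2 ?eqxx ?subD1set // => E.
have addff (x y : 'F_2) : (x + y = 0 -> x = y)%R.
  by move=> /eqP; rewrite addr_eq0 oppr_pchar2 ?pchar_Fp // => /eqP.
rewrite (addff _ _ E).
rewrite (reindex_onto (fun t' => t' :\ v) (fun t' => v |: t')) /=; last first.
  move=> t' /andP[]; rewrite inE => /andP[/andP[t'L /eqP ct'] tt'] ne.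
  rewrite setU1K //; apply: contra ne => vt'.
  rewrite eq_sym eqEcard ct2 ct' leqnn andbT -(setD1K vt) subUset sub1set vt'.
  by [].
apply: eq_bigl => t'.
rewrite !inE; apply/idP/idP.
  move=> /andP[/andP[/andP[/andP[t'L /eqP ct'] tt'] ne] /eqP e].
  have vt' : v \in t' by rewrite -e setU11.
  have ttt' : t \subset t' by rewrite -(setD1K vt) -e setUS // .
  rewrite ttt' vt' (cardsD1 v) vt' ct' eqxx !andbT.
  have pt' : p <= #|t' :\ v| by rewrite ct'; apply: leq_trans pi _.
  have [s'F t's'] := sgP _ t'L.
  have s's : sg (t' :\ v) = s.
    apply: (@packed_uniq (t :\ v)) => //; first by rewrite ctv.
      exact: subset_trans t's'.
    exact: subset_trans (subD1set _ _) ts.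
  apply: (Ldn s) => //; first by apply/set0Pn; exists v.
  by rewrite -e subUset sub1set vs -s's.
move=> /andP[/andP[t'L /eqP ct'] /andP[tt' vt']].
have c : #|t' :\ v| = i.+2 by move: ct'; rewrite (cardsD1 v) vt' => -[].
rewrite c eqxx setD1K // eqxx setSD // !andbT; apply/andP; split.
  by apply: (Ldn t'); rewrite ?subD1set // -card_gt0 c.
by apply: contraTneq vt => <-; rewrite !inE eqxx.
Qed.

(** Double counting of the pairs formed by a member of F and one of its faces:
    a face with more than p vertices belongs to a single member. *)
Lemma fnum_packed i : p <= i -> fnum L i = \sum_(s in F) 'C(#|s|, i.+1).
Proof.
move=> pi; have [/complexP[_ Ldn] FL LFs _] := LF.
rewrite /fnum -sum1_card.
transitivity (\sum_(t in simplices L i) \sum_(s in F | t \subset s) 1).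
  apply: eq_bigr => t; rewrite inE => /andP[tL /eqP ct].
  have [s sF ts] := LFs _ tL.
  rewrite (big_pred1 s) // => s' /=; apply/andP/eqP => [[s'F ts'] | -> //].
  by apply: (@packed_uniq t); rewrite // ct; apply: leq_trans pi _.
rewrite (exchange_big_dep (mem F)) /=; last by move=> t s _ /andP[].
apply: eq_bigr => s sF; rewrite -cards_draws -sum1_card.
apply: eq_bigl => t; rewrite !inE sF /=.
have [ts|] := boolP (t \subset s); rewrite ?andbF //= andbT.
have [ct|] := boolP (#|t| == i.+1); rewrite ?andbF //= andbT.
by apply: (Ldn s); rewrite // ?(subsetP FL) // -card_gt0 (eqP ct).
Qed.

(** The weight is at most the number of (p+1)-dimensional faces, since
    C(m - 1, p + 1) is at most C(m, p + 2). *)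
Lemma weight_leq_card : weight F <= #|L|.
Proof.
apply: (@leq_trans (fnum L p.+1)); last first.
  by apply: subset_leq_card; apply/subsetP => t; rewrite inE => /andP[].
rewrite fnum_packed //; apply: leq_sum => s _.
by case: #|s| => [|m] //=; rewrite binS leq_addl.
Qed.

(** Pascal's rule makes the sum telescope. *)
Lemma alternating_bin (R : pzRingType) m b : 0 < m -> m <= b ->
  (\sum_(p.+1 <= i < b) (-1) ^+ (i.+1 - p) * 'C(m, i.+1)%:R = 'C(m.-1, p.+1)%:R :> R)%R.
Proof.
case: m => // m _ mb /=.
have [bp|pb] := leqP b p.+1.
  by rewrite big_geq // bin_small //; apply: leq_trans mb _.
have tel : forall b', p < b' -> (\sum_(p.+1 <= i < b') (-1) ^+ (i.+1 - p) * 'C(m.+1, i.+1)%:R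
   = 'C(m, p.+1)%:R + (-1) ^+ (b' - p) * 'C(m, b')%:R :> R)%R.
  elim=> // b' IH; rewrite ltnS leq_eqVlt => /orP[/eqP <-|pb'].
    by rewrite big_geq // subSnn expr1 mulN1r subrr.
  rewrite big_nat_recr //= IH // binS natrD mulrDr -!addrA; congr (_ + _)%R.
  rewrite addrCA [X in (_ + X)%R](_ : _ = 0%R) ?addr0 //.
  by rewrite subSn 1?ltnW // exprS -mulrA mulN1r subrr.
by rewrite (tel _ (ltnW pb)) (bin_small mb) mulr0 addr0.
Qed.

Lemma Mfun_packed (R : realFieldType) (nu : R) :
  Mfun p nu L = (nu * (1 - nu) * (nu ^+ p + (1 - nu) ^+ p) * (weight F)%:R)%R.
Proof.
have [/complexP[Ln0 _] FL _ _] := LF.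
rewrite /Mfun betti_packed // mulr0 add0r; congr (_ * _)%R.
transitivity (\sum_(p.+1 <= i < csize L) \sum_(s in F)
    (-1) ^+ (i.+1 - p) * 'C(#|s|, i.+1)%:R : R)%R.
  apply: eq_big_nat => i /andP[pi _].
  rewrite betti_packed ?fnum_packed 1?ltnW // subr0 natr_sum.
  by rewrite mulr_sumr.
rewrite exchange_big natr_sum; apply: eq_bigr => s sF /=.
have sL : s \in L by apply: (subsetP FL).
by rewrite alternating_bin // ?card_gt0 ?Ln0 // /csize leq_bigmax_cond.
Qed.
End Packed.
End PackedComplexes.

(** * The ascent tiling of the subdivided tiles *)

(** A tile is an interval of the face lattice: its simplices are those between
    the set R of vertices opposite to the removed facets and the whole c. *)
Lemma mem_tile_support (W : finType) (c R t : {set W}) :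
  (t \in tile_support (c, [set c :\ a | a in R])) =
  [&& t != set0, t \subset c & R \subset t].
Proof.
rewrite /tile_support in_setD inE /= andbC -andbA.
have [t0|] //= := boolP (t != set0); have [tc|] //= := boolP (t \subset c).
apply/negP/subsetP => [H a aR | H /bigcupP[_ /imsetP[a aR ->]]]; last first.
  by rewrite inE t0 /= => /subsetP/(_ _ (H a aR)); rewrite !inE eqxx.
apply: contraT => na; case: H; apply/bigcupP; exists (c :\ a); first exact: imset_f.
by rewrite inE t0 subsetD1 tc.
Qed.

Lemma mem_sd (W : finType) (K : {set {set W}}) (c : {set {set W}}) :
  reflect [/\ c != set0, c \subset K &
     forall A B, A \in c -> B \in c -> (A \subset B) || (B \subset A)] (c \in sd K).
Proof.
rewrite inE; apply: (iffP and3P) => -[H1 H2 H3]; split=> //.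
  by move=> A B At Bt; have /'forall_in_'forall_implyP := H3; move/(_ A At B Bt).
by apply/'forall_in_'forall_implyP => A At B Bt; apply: H3.
Qed.

Lemma card_ord_lt m k : k <= m -> #|[set i : 'I_m | i < k]| = k.
Proof.
move=> km; rewrite -sum1_card (eq_bigl (fun i : 'I_m => i < k)).
  by rewrite (big_ord_narrow km) sum1_card card_ord.
by move=> i; rewrite inE.
Qed.

Lemma setD1_inj (W : finType) (c : {set W}) : {in c &, injective (fun a => c :\ a)}.
Proof.
move=> a b ac bc /setP/(_ a); rewrite !inE eqxx ac /=.
by rewrite andbT => /esym/negbFE/eqP.
Qed.

Lemma tile_decomp (W : finType) (x : {set W} * {set {set W}}) : x.2 \subset facets x.1 ->
  exists R : {set W}, [/\ R \subset x.1, x = (x.1, [set x.1 :\ a | a in R]) & #|R| = #|x.2|].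
Proof.
case: x => c F /= Fc; pose R := [set a in c | c :\ a \in F].
have Rc : R \subset c by apply/subsetP => a; rewrite inE => /andP[].
have FE : F = [set c :\ a | a in R].
  apply/setP => f; apply/idP/imsetP => [fF | [a]]; last by rewrite inE => /andP[_ H ->].
  have /imsetP[a ac fE] := subsetP Fc _ fF.
  by exists a; rewrite // inE ac -fE.
exists R; rewrite -FE; split=> //; rewrite [in RHS]FE card_in_imset //.
by move=> a b /(subsetP Rc) ac /(subsetP Rc) bc; apply: setD1_inj.
Qed.

Section Flags.
Variable n : nat.
Local Notation V := 'I_n.+1.
Local Notation tile := ({set {set V}} * {set {set {set V}}})%type.
Implicit Types (T : {set tile}) (x y : V) (A B : {set V}) (t c : {set {set V}}) (pi : {perm V}).

Lemma sd_DeltaP t : reflect [/\ t != set0, set0 \notin t &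
  forall A B, A \in t -> B \in t -> (A \subset B) || (B \subset A)] (t \in sd (Delta n)).
Proof.
apply: (iffP (mem_sd _ _)) => -[H1 H2 H3]; split=> //.
  by apply/negP => /(subsetP H2); rewrite !inE eqxx.
apply/subsetP => A At; rewrite !inE subsetT andbT.
by apply: contraNneq H2 => <-.
Qed.

Lemma mem_sdT s t : reflect (t \in sd (Delta n) /\
  forall i : V, i < s -> exists2 A, A \in t & i \in A) (t \in sdT n s).
Proof.
rewrite in_setD andbC; apply: (iffP andP) => -[tD H]; split=> //.
  move=> i is_; have [t0 n0 tch] := sd_DeltaP _ tD.
  have [/existsP[A /andP[At iA]]|] := boolP [exists A in t, i \in A]; first by exists A.
  rewrite negb_exists => /forallP Hn; case/bigcupP: H; exists i => //.
  rewrite inE t0 /=; apply/andP; split.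
    apply/subsetP => A At; have := Hn A; rewrite At /= => iA.
    rewrite inE; apply/andP; split; first by apply: contraNneq n0 => <-.
    by apply/subsetP => x xA; rewrite !inE; apply: contraNneq iA => <-.
  by apply/'forall_in_'forall_implyP => A At B Bt; apply: tch.
apply/bigcupP => -[i is_]; rewrite inE => /and3P[_ /subsetP tS _].
have [A At iA] := H i is_; have := tS _ At; rewrite inE => /andP[_ /subsetP /(_ i iA)].
by rewrite !inE eqxx.
Qed.

Definition initial pi (k : V) : {set V} := [set x | pi x <= k].
Definition flag pi : {set {set V}} := [set initial pi k | k : V].
(** The inverse of pi, extended by the value s after the last position: the
    facets opposite to 0, .., s - 1 are removed from T_s, and the vertex setT of
    the flag is compulsory exactly when the last entry of pi is one of them. *)
Definition label (s : nat) pi (k : nat) : nat :=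
  if insub k is Some j then (pi^-1)%g (j : V) : nat else s.
Definition ascents s pi : {set V} := [set k : V | label s pi k < label s pi k.+1].
(** The faces of the flag at the ascents of pi are made compulsory, so that the
    tile consists of the chains that give back pi when each of their gaps is
    filled decreasingly. *)
Definition perm_tile s pi : {set {set V}} * {set {set {set V}}} :=
  (flag pi, [set flag pi :\ A | A in initial pi @: ascents s pi]).

Lemma label_perm s pi x : label s pi (pi x) = x.
Proof. by rewrite /label valK permK. Qed.

Lemma label_last s pi : label s pi n.+1 = s.
Proof. by rewrite /label insubN // ltnn. Qed.

Lemma card_initial pi k : #|initial pi k| = k.+1.
Proof.
have -> : initial pi k = (pi^-1)%g @: [set i : V | i < k.+1].
  apply/setP => x; rewrite inE; apply/idP/imsetP => [xk | [i]].
    by exists (pi x); rewrite ?inE ?permK.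
  by rewrite inE ltnS => ik ->; rewrite permKV.
by rewrite card_imset ?card_ord_lt //; exact: perm_inj.
Qed.

Lemma initial_inj pi : injective (initial pi).
Proof. by move=> j k /(congr1 (fun A : {set V} => #|A|)); rewrite !card_initial => -[/val_inj]. Qed.

Lemma card_flag pi : #|flag pi| = n.+1.
Proof. by rewrite card_imset ?card_ord //; exact: initial_inj. Qed.

Lemma flag_chain pi : flag pi \in sd (Delta n).
Proof.
apply/sd_DeltaP; split.
- by rewrite -card_gt0 card_flag.
- by apply/negP => /imsetP[k _ /esym/eqP]; rewrite -cards_eq0 card_initial.
- move=> _ _ /imsetP[j _ ->] /imsetP[k _ ->]; case/orP: (leq_total j k) => jk.
    by apply/orP; left; apply/subsetP => x; rewrite !inE => /leq_trans; apply.
  by apply/orP; right; apply/subsetP => x; rewrite !inE => /leq_trans; apply.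
Qed.

Lemma sub_sd_Delta t c : c \in sd (Delta n) -> t \subset c -> t != set0 -> t \in sd (Delta n).
Proof.
move=> /sd_DeltaP[c0 n0 cch] /subsetP tc t0; apply/sd_DeltaP; split=> //.
  by apply: contra n0; apply: tc.
by move=> A B /tc Ac /tc Bc; apply: cch.
Qed.

(** For a chain t, the step of t at which x enters. *)
Definition level t x : nat := #|[set A in t | x \notin A]|.
(** The linear order obtained from the chain t by listing each step in
    decreasing order; the tile that contains t is that of this order. *)
Definition before t x y : bool := (level t x < level t y) || ((level t x == level t y) && (y < x)).
Definition rank_before t x : nat := #|[set y | before t y x]|.

Lemma before_irr t x : before t x x = false.
Proof. by rewrite /before !ltnn andbF. Qed.

Lemma before_trans t y x z : before t x y -> before t y z -> before t x z.
Proof.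
rewrite /before => /orP[xy | /andP[/eqP -> yx]] /orP[yz | /andP[/eqP <- zy]].
- by rewrite (ltn_trans xy).
- by rewrite xy.
- by rewrite yz.
- by rewrite eqxx (ltn_trans zy) ?orbT.
Qed.

Lemma before_total t x y : x != y -> before t x y || before t y x.
Proof.
rewrite /before => xy; case: ltngtP => //= _.
by case: ltngtP => // /val_inj e; rewrite e eqxx in xy.
Qed.

Lemma rank_before_mono t x y : before t x y -> rank_before t x < rank_before t y.
Proof.
move=> xy; apply/proper_card/properP; split.
  by apply/subsetP => z; rewrite !inE => zx; apply: before_trans xy.
by exists x; rewrite !inE ?before_irr.
Qed.

Lemma rank_before_ltn t x y : (rank_before t x < rank_before t y) = before t x y.
Proof.
apply/idP/idP => [|/rank_before_mono //]; apply: contraTT => nxy; rewrite -leqNgt.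
have [-> //|xy] := eqVneq x y.
by have := before_total t xy; rewrite (negbTE nxy) /= => /rank_before_mono/ltnW.
Qed.

Lemma rank_before_lt t x : rank_before t x < n.+1.
Proof.
rewrite -[n.+1]card_ord -cardsT; apply/proper_card/properP; split=> //.
by exists x; rewrite ?inE ?before_irr.
Qed.

Lemma rank_before_inj t : injective (fun x => Ordinal (rank_before_lt t x)).
Proof.
move=> x y /(congr1 val) /= e; apply/eqP; apply: contraT => /(before_total t).
by rewrite -!rank_before_ltn e ltnn.
Qed.

Definition chain_perm t : {perm V} := perm (@rank_before_inj t).

Lemma chain_permE t x : chain_perm t x = rank_before t x :> nat.
Proof. by rewrite permE. Qed.

Lemma level_sep t A x y : t \in sd (Delta n) -> A \in t -> x \in A -> y \notin A ->
  level t x < level t y.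
Proof.
move=> /sd_DeltaP[_ _ tch] At xA yA; apply/proper_card/properP; split.
  apply/subsetP => B; rewrite !inE => /andP[Bt xB]; rewrite Bt /=.
  by case/orP: (tch A B At Bt) => /subsetP H; [rewrite H in xB | apply: contra yA; apply: H].
by exists A; rewrite !inE At ?yA ?xA.
Qed.

Lemma sep_level t x y : level t x < level t y -> exists2 A, A \in t & (x \in A) && (y \notin A).
Proof.
move=> xy; have [/existsP[A /andP[At H]]|] := boolP [exists A in t, (x \in A) && (y \notin A)].
  by exists A.
rewrite negb_exists => /forallP H; move: xy; rewrite ltnNge => /negP[].
apply: subset_leq_card; apply/subsetP => A; rewrite !inE => /andP[At yA].
by have := H A; rewrite At yA /= andbT.
Qed.

Lemma before_mem t A x y : t \in sd (Delta n) -> A \in t -> x \in A -> before t y x -> y \in A.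
Proof.
move=> tD At xA; apply: contraTT => yA; have := level_sep tD At xA yA.
by rewrite /before; case: ltngtP.
Qed.

Lemma chain_sub_flag t : t \in sd (Delta n) -> t \subset flag (chain_perm t).
Proof.
move=> tD; apply/subsetP => A At.
have cA : 0 < #|A|.
  by rewrite card_gt0; case/sd_DeltaP: tD => _ n0 _; apply: contraNneq n0 => <-.
have cA' : #|A|.-1 < n.+1 by rewrite prednK // (leq_trans (max_card _)) // card_ord.
apply/imsetP; exists (Ordinal cA') => //; apply/setP => x; rewrite inE chain_permE /=.
have [xA|xA] := boolP (x \in A); apply/esym.
  rewrite -ltnS prednK //; apply/proper_card/properP; split; last first.
    by exists x; rewrite ?inE ?before_irr.
  by apply/subsetP => y; rewrite inE; apply: before_mem.
apply/negbTE; rewrite -ltnNge prednK //; apply: subset_leq_card.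
apply/subsetP => y yA; rewrite inE.
by have := level_sep tD At yA xA; rewrite /before => ->.
Qed.

(** Within a step of t the order decreases, so an ascent can only occur at the
    end of a step, where the initial segment is an element of t. *)
Lemma ascents_mem s t k : t \in sdT n s ->
  k \in ascents s (chain_perm t) -> initial (chain_perm t) k \in t.
Proof.
case/mem_sdT => tD tS; set pi := chain_perm t.
have [x ->] : exists x, k = pi x by exists ((pi^-1)%g k); rewrite permKV.
rewrite inE label_perm.
have tf A : A \in t -> exists j, A = initial pi j.
  by move/(subsetP (chain_sub_flag tD))/imsetP => [j _ ->]; exists j.
have [pn|pn] := eqVneq (pi x : nat) n.
  rewrite pn label_last => /tS[A At xA]; have [j Aj] := tf _ At.
  move: xA; rewrite Aj inE => xj; suff -> : pi x = j by rewrite -Aj.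
  by apply: val_inj; apply/eqP; rewrite eqn_leq xj /= pn -ltnS ltn_ord.
have pn' : (pi x).+1 < n.+1 by rewrite ltn_neqAle eqSS pn /=.
set y := (pi^-1)%g (Ordinal pn').
have yE : (pi x).+1 = pi y by rewrite permKV.
rewrite yE label_perm => xy.
have : before t x y by rewrite -rank_before_ltn -!chain_permE -/pi -yE.
rewrite /before orbC ltnNge (ltnW xy) andbF /= => /sep_level[A At].
have [j Aj] := tf _ At; rewrite Aj !inE -yE -ltnNge ltnS => /anti_leq e.
by rewrite (val_inj e) -Aj.
Qed.

Lemma label_desc s pi a b : a <= b ->
  (forall k, a <= k < b -> label s pi k.+1 <= label s pi k) -> label s pi b <= label s pi a.
Proof.
elim: b => [|b IH]; first by rewrite leqn0 => /eqP ->.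
rewrite leq_eqVlt => /orP[/eqP -> // | ab] H; apply: leq_trans (H b _) (IH _ _).
- by rewrite -ltnS ab /=.
- by rewrite -ltnS.
- by move=> k /andP[ak kb]; apply: H; rewrite ak ltnW.
Qed.

Lemma mem_perm_tile s pi t : (t \in tile_support (perm_tile s pi)) =
  [&& t != set0, t \subset flag pi & initial pi @: ascents s pi \subset t].
Proof. exact: mem_tile_support. Qed.

(** Two elements of the same level are separated by no element of t, hence by
    no ascent, so that pi lists them decreasingly. *)
Lemma perm_tile_uniq s pi t : t \in tile_support (perm_tile s pi) -> pi = chain_perm t.
Proof.
rewrite mem_perm_tile => /and3P[t0 tf /subsetP ta].
have tD := sub_sd_Delta (flag_chain pi) tf t0.
have mono x y : pi x < pi y -> before t x y.
  move=> xy; have le : level t x <= level t y.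
    apply: subset_leq_card; apply/subsetP => A; rewrite !inE => /andP[At].
    rewrite At /=; case/(subsetP tf)/imsetP: At => k _ ->; rewrite !inE.
    by apply: contra => /(leq_trans (ltnW xy)).
  rewrite /before; case: ltngtP le => //= e _.
  rewrite ltn_neqAle; apply/andP; split.
    by apply: contraTneq xy => /val_inj ->; rewrite ltnn.
  rewrite -(label_perm s pi x) -(label_perm s pi y); apply: label_desc (ltnW xy) _.
  move=> k /andP[xk ky]; have kn : k < n.+1 by apply: ltn_trans ky (ltn_ord _).
  rewrite leqNgt; apply/negP => kasc.
  have kt : initial pi (Ordinal kn) \in t by apply: ta; apply: imset_f; rewrite inE.
  have := @level_sep t _ x y tD kt; rewrite !inE -ltnNge xk ky e ltnn.
  by move=> /(_ isT isT).
have iff x y : (pi x < pi y) = before t x y.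
  apply/idP/idP => [/mono // | xy]; rewrite ltnNge leq_eqVlt negb_or.
  apply/andP; split; last first.
    by apply/negP => /mono yx; have := before_trans xy yx; rewrite before_irr.
  by apply: contraTneq xy => /val_inj/perm_inj ->; rewrite before_irr.
apply/permP => x; apply: val_inj; rewrite /= chain_permE /rank_before.
have -> : [set y | before t y x] = (pi^-1)%g @: [set i : V | i < pi x].
  apply/setP => y; rewrite inE -iff; apply/idP/imsetP => [yx | [i]].
    by exists (pi y); rewrite ?inE ?permK.
  by rewrite inE => ix ->; rewrite permKV.
by rewrite card_imset ?card_ord_lt // 1?ltnW //; exact: perm_inj.
Qed.

(** If no element of t contained some i < s, there would be no ascent from the
    position of i on, and i would be at least the final label s. *)
Lemma perm_tile_sdT s pi t : s <= n.+1 -> t \in tile_support (perm_tile s pi) -> t \in sdT n s.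
Proof.
move=> sn; rewrite mem_perm_tile => /and3P[t0 tf /subsetP ta].
apply/mem_sdT; split; first exact: sub_sd_Delta (flag_chain pi) tf t0.
move=> i is_; have [/existsP[A /andP[At iA]]|] := boolP [exists A in t, i \in A].
  by exists A.
rewrite negb_exists => /forallP Hn.
suff : label s pi n.+1 <= label s pi (pi i) by rewrite label_last label_perm leqNgt is_.
apply: label_desc => [|k /andP[ik kn]]; first exact: ltnW.
rewrite leqNgt; apply/negP => kasc.
have kt : initial pi (Ordinal kn) \in t by apply: ta; apply: imset_f; rewrite inE.
by have := Hn (initial pi (Ordinal kn)); rewrite kt inE /= ik.
Qed.

Definition perm_tiling s := [set perm_tile s pi | pi : {perm V}].

Lemma card_removed_facets s pi : #|(perm_tile s pi).2| = #|ascents s pi|.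
Proof.
rewrite /= !card_in_imset //; first by move=> j k _ _ /initial_inj.
move=> A B /imsetP[j _ ->] /imsetP[k _ ->] /setP/(_ (initial pi j)).
rewrite !inE eqxx /= => /esym; rewrite imset_f // andbT => /negbFE/eqP //.
Qed.

Lemma perm_tilingP s : s <= n.+1 -> is_tiling s (perm_tiling s).
Proof.
move=> sn; apply/and3P; split.
- apply/'forall_implyP => _ /imsetP[pi _ ->] /=.
  rewrite flag_chain card_flag eqxx /=; apply/subsetP => c /imsetP[A].
  case/imsetP => k _ -> ->; apply/imsetP; exists (initial pi k) => //.
  by rewrite imset_f.
- apply/'forall_implyP => _ /imsetP[pi _ ->]; apply/subsetP => t.
  exact: perm_tile_sdT.
- apply/'forall_implyP => t tT; apply/cards1P; exists (perm_tile s (chain_perm t)).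
  apply/setP => x; rewrite in_set1 in_set; apply/andP/eqP => [[xT] | ->].
    by case/imsetP: xT => pi _ -> tx; rewrite -(perm_tile_uniq tx).
  have [tD _] := mem_sdT _ _ tT; have [t0 _ _] := sd_DeltaP _ tD.
  rewrite imset_f // mem_perm_tile t0 chain_sub_flag //=; split=> //.
  by apply/subsetP => _ /imsetP[k ka ->]; apply: ascents_mem tT ka.
Qed.

Lemma tiling_uniq s T t (x y : tile) : is_tiling s T -> x \in T -> y \in T ->
  t \in tile_support x -> t \in tile_support y -> x = y.
Proof.
case/and3P => _ /'forall_implyP Ts /'forall_implyP Tu xT yT tx ty.
have tT := subsetP (Ts x xT) t tx.
have /cards1P[z Ez] := Tu t tT.
have : x \in [set z] by rewrite -Ez in_set xT.
have : y \in [set z] by rewrite -Ez in_set yT.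
by rewrite !in_set1 => /eqP -> /eqP ->.
Qed.

Lemma tiling_cover s T t : is_tiling s T -> t \in sdT n s ->
  exists2 x, x \in T & t \in tile_support x.
Proof.
case/and3P => _ _ /'forall_implyP Tu /Tu /cards1P[x Ex].
by have := set11 x; rewrite -Ex in_set => /andP[]; exists x.
Qed.

Lemma sdT_single s (A : {set V}) : A != set0 -> (forall i : V, i < s -> i \in A) ->
  [set A] \in sdT n s.
Proof.
move=> A0 As; apply/mem_sdT; split=> [|i /As]; last by exists A; rewrite ?inE.
apply/sd_DeltaP; split.
- by apply/set0Pn; exists A; rewrite inE.
- by rewrite inE eq_sym.
- by move=> B C; rewrite !inE => /eqP -> /eqP ->; rewrite subxx.
Qed.

Lemma setT_sdT s : [set [set: V]] \in sdT n s.
Proof. by apply: sdT_single => [|i _]; [apply/set0Pn; exists ord0|]; rewrite inE. Qed.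

(** A permutation without ascent has all its labels at least s, which excludes
    s > 0. For s = 0 the tiles of type T_0 are those that contain the vertex
    setT, and exactly one tile does. *)
Lemma hcount_perm_tiling s : s <= n.+1 -> hcount (perm_tiling s) 0 = (s == 0).
Proof.
move=> sn; rewrite /hcount.
have [->|s0] := eqVneq s 0; last first.
  apply/eqP; rewrite cards_eq0 -subset0; apply/subsetP => x; rewrite !inE.
  move=> /andP[/imsetP[pi _ ->]]; rewrite card_removed_facets cards_eq0 => /eqP a0.
  have : label s pi n.+1 <= label s pi (pi ord0).
    apply: label_desc => [|k /andP[_ kn]]; first exact: ltnW.
    rewrite leqNgt; apply/negP => ka.
    have : Ordinal kn \in ascents s pi by rewrite inE.
    by rewrite a0 inE.
  by rewrite label_last label_perm leqn0 (negbTE s0).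
apply/eqP; have /and3P[_ _ /'forall_implyP/(_ _ (setT_sdT 0))] := perm_tilingP (leq0n n.+1).
congr (_ == _); apply: eq_card => x; rewrite in_set [in RHS]in_set.
have [/imsetP[pi _ xE]|//] := boolP (x \in perm_tiling 0); rewrite xE.
rewrite !andTb.
rewrite card_removed_facets cards_eq0 mem_perm_tile.
have -> : [set [set: V]] != set0 by apply/set0Pn; exists setT; rewrite inE.
have segn : initial pi ord_max = setT.
  by apply/setP => y; rewrite !inE -ltnS ltn_ord.
have -> : [set [set: V]] \subset flag pi.
  by rewrite sub1set -segn imset_f.
rewrite !andTb; apply/subsetP/eqP => [H | -> A /imsetP[k]]; last by rewrite inE.
apply/setP => k; rewrite [RHS]inE; apply/negP => ka.
have := H _ (imset_f _ ka); rewrite inE -segn => /eqP/initial_inj kn.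
by move: ka; rewrite inE kn label_last ltn0.
Qed.

Lemma the_tilingP s : s <= n.+1 ->
  is_tiling s (the_tiling n s) /\ hcount (the_tiling n s) 0 = (s == 0).
Proof.
move=> sn; rewrite /the_tiling; case: pickP => [T /andP[HT /eqP h] // | /(_ (perm_tiling s))].
by rewrite perm_tilingP // hcount_perm_tiling // eqxx.
Qed.

Definition flags : {set {set {set V}}} := [set c in sd (Delta n) | #|c| == n.+1].

Lemma chain_flag t : t \in sd (Delta n) -> exists2 c, c \in flags & t \subset c.
Proof.
move=> tD; exists (flag (chain_perm t)); last exact: chain_sub_flag.
by rewrite inE flag_chain card_flag eqxx.
Qed.

(** Flags are in bijection with permutations: a flag is contained in the flag of
    the permutation that it defines. *)
Lemma card_flags : #|flags| = n.+1`!.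
Proof.
have -> : flags = [set flag pi | pi : {perm V}].
  apply/setP => c; rewrite inE; apply/andP/imsetP => [[cD /eqP cc] | [pi _ ->]].
    exists (chain_perm c) => //; apply/eqP; rewrite eqEcard card_flag cc leqnn andbT.
    exact: chain_sub_flag.
  by rewrite flag_chain card_flag.
rewrite card_imset ?card_Sn // => pi pi' e.
have H pi1 : flag pi1 \in tile_support (perm_tile 0 pi1).
  rewrite mem_perm_tile -card_gt0 card_flag subxx /=.
  by apply/subsetP => _ /imsetP[k _ ->]; apply: imset_f.
by rewrite (perm_tile_uniq (H pi)) e -(perm_tile_uniq (H pi')).
Qed.


(** * Counting the tiles of a tiling *)

Definition is_tile (x : {set {set V}} * {set {set {set V}}}) :=
  (x.1 \in flags) && (x.2 \subset facets x.1).

Lemma tiling_tile s T (x : tile) : is_tiling s T -> x \in T -> is_tile x.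
Proof.
by case/and3P => /'forall_implyP H _ _ /H /and3P[h1 h2 h3]; rewrite /is_tile inE h1 h2.
Qed.

Lemma tile_top_mem (x : tile) : is_tile x -> x.1 \in tile_support x.
Proof.
case/andP; rewrite inE => /andP[/sd_DeltaP[c0 _ _] _] /tile_decomp[R [Rc -> _]].
by rewrite mem_tile_support c0 subxx Rc.
Qed.

Lemma card_removed_lt (x : tile) : is_tile x -> #|x.2| < n.+2.
Proof.
case/andP; rewrite inE => /andP[_ /eqP cx] /tile_decomp[R [Rc _ <-]].
by rewrite ltnS (leq_trans (subset_leq_card Rc)) ?cx.
Qed.

(** Only the top simplex of a tile has n + 1 vertices, so that tiles correspond
    to flags. *)
Lemma tile_flag_eq (x : tile) c : is_tile x -> c \in flags -> c \in tile_support x -> x.1 = c.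
Proof.
case/andP; rewrite inE => /andP[_ /eqP cx] /tile_decomp[R [Rc -> _]].
rewrite inE mem_tile_support => /andP[_ /eqP cc] /and3P[_ cx1 _] /=.
by apply/esym/eqP; rewrite eqEcard cx1 cx cc leqnn.
Qed.

Lemma flag_setT c : c \in flags -> [set: V] \in c.
Proof.
rewrite inE => /andP[cD /eqP cc].
suff -> : c = flag (chain_perm c).
  apply/imsetP; exists ord_max => //; apply/setP => x; rewrite !inE.
  by rewrite -ltnS ltn_ord.
by apply/eqP; rewrite eqEcard card_flag cc leqnn chain_sub_flag.
Qed.

Lemma flag_sdT s c : c \in flags -> c \in sdT n s.
Proof.
move=> cf; apply/mem_sdT; split; first by move: cf; rewrite inE => /andP[].
by move=> i _; exists setT; [exact: flag_setT | rewrite inE].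
Qed.

Lemma card_tiling s T : is_tiling s T -> #|T| = n.+1`!.
Proof.
move=> HT; rewrite -card_flags.
have -> : flags = [set x.1 | x in T].
  apply/setP => c; apply/idP/imsetP => [cf | [x xT ->]].
    have [x xT cx] := tiling_cover HT (flag_sdT s cf).
    by exists x; rewrite // (tile_flag_eq (tiling_tile HT xT) cf).
  by case/andP: (tiling_tile HT xT).
rewrite card_in_imset // => x y xT yT e.
have hx := tile_top_mem (tiling_tile HT xT).
have hy := tile_top_mem (tiling_tile HT yT).
by apply: (tiling_uniq HT xT yT hx); rewrite e.
Qed.

Lemma sum_tiling s T (v : nat -> nat) : is_tiling s T ->
  \sum_(x in T) v #|x.2| = \sum_(t < n.+2) hcount T t * v t.
Proof.
move=> HT.
transitivity (\sum_(x in T) \sum_(t < n.+2 | t == #|x.2| :> nat) v t).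
  apply: eq_bigr => x xT; rewrite (big_pred1 (Ordinal (card_removed_lt (tiling_tile HT xT)))) //.
rewrite (exchange_big_dep xpredT) //=; apply: eq_bigr => t _.
rewrite sum_nat_const; congr (_ * _); apply: eq_card => x.
by rewrite !inE eq_sym.
Qed.

Lemma single_tile (x : tile) A : is_tile x -> [set A] \in tile_support x ->
  (A \in x.1) && (#|x.2| <= 1).
Proof.
case/andP => _ /tile_decomp[R [Rc -> cR]]; rewrite mem_tile_support => /and3P[_].
rewrite sub1set => /= -> RA; rewrite card_in_imset; last first.
  by move=> a b /(subsetP Rc) ac /(subsetP Rc) bc; apply: setD1_inj.
by rewrite -(cards1 A) subset_leq_card.
Qed.

(** Only tiles of types T_0 and T_1 contain vertices. If s > 0 there is no tile
    of type T_0. If s = 0 there is a single one, and it cannot contain both of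
    the vertices [set ord0] and [set ord_max], which do not form a chain. *)
Lemma hcount1_gt0 s T : 0 < n -> is_tiling s T -> hcount T 0 = (s == 0) -> 0 < hcount T 1.
Proof.
move=> n0 HT h0.
suff [x xT x1] : exists2 x, x \in T & #|x.2| = 1.
  by rewrite card_gt0; apply/set0Pn; exists x; rewrite inE xT x1.
have H1 (x : tile) A : x \in T -> [set A] \in tile_support x -> #|x.2| != 0 -> #|x.2| = 1.
  move=> xT /(single_tile (tiling_tile HT xT))/andP[_].
  by case: #|_| => // -[].
have [s0|s0] := eqVneq s 0; last first.
  have [x xT tx] := tiling_cover HT (setT_sdT s).
  exists x; rewrite // (H1 x setT) //; apply: contra_eqN h0 => x0.
  rewrite (negbTE s0) -lt0n card_gt0; apply/set0Pn; exists x.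
  by rewrite in_set xT x0.
have S1 i : [set [set i : V]] \in sdT n s.
  apply: sdT_single; first by apply/set0Pn; exists i; rewrite inE.
  by move=> j; rewrite s0.
have [x xT tx] := tiling_cover HT (S1 ord0).
have [y yT ty] := tiling_cover HT (S1 ord_max).
have [x0|/(H1 _ _ xT tx)] := eqVneq #|x.2| 0; last by exists x.
have [y0|/(H1 _ _ yT ty)] := eqVneq #|y.2| 0; last by exists y.
have /cards1P[z zE] : #|[set x in T | #|x.2| == 0]| == 1 by rewrite -/(hcount T 0) h0 s0.
have xz : x \in [set z] by rewrite -zE in_set xT x0.
have yz : y \in [set z] by rewrite -zE in_set yT y0.
move: ty; move: xz yz; rewrite !in_set1 => /eqP xz /eqP ->; rewrite -xz => ty.
have /andP[A1 _] := single_tile (tiling_tile HT xT) tx.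
have /andP[A2 _] := single_tile (tiling_tile HT xT) ty.
have /andP[] := tiling_tile HT xT; rewrite inE => /andP[/sd_DeltaP[_ _ ch] _] _.
have := ch _ _ A1 A2.
by rewrite !sub1set !inE -!val_eqE /= eq_sym orbb => /eqP n0'; rewrite n0' in n0.
Qed.

End Flags.

(** * Carriers and copies in iterated subdivisions *)

Section Levels.
Variable n : nat.
Local Notation V := 'I_n.+1.
Local Notation tile := ({set {set V}} * {set {set {set V}}})%type.

Lemma sd_top (W : finType) (K : {set {set W}}) (c : {set {set W}}) : c \in sd K ->
  exists2 A, A \in c & forall B, B \in c -> B \subset A.
Proof.
case/mem_sd => /set0Pn[A0 A0c] _ ch.
case: (@arg_maxnP _ A0 (mem c) (fun A => #|A|) A0c) => A Ac Amax.
exists A => // B Bc; case/orP: (ch A B Ac Bc) => // AB.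
have le : #|B| <= #|A| := Amax B Bc.
by have /eqP <- : A == B by rewrite eqEcard AB.
Qed.

(** The face of Delta_n whose interior contains the vertex. *)
Fixpoint vsupp d : sdV V d -> {set V} :=
  match d return sdV V d -> {set V} with
  | 0 => fun x => [set x]
  | d'.+1 => fun A => \bigcup_(a in (A : {set sdV V d'})) vsupp a
  end.
Definition supp d (t : {set sdV V d}) : {set V} := \bigcup_(a in t) vsupp a.

(** Sd^(d+1)(Delta_n) is also the d-th subdivision of Sd(Delta_n): this is the
    simplex of Sd(Delta_n) whose interior contains the vertex. *)
Fixpoint vsd_supp d : sdV V d.+1 -> {set {set V}} :=
  match d return sdV V d.+1 -> {set {set V}} with
  | 0 => fun A => [set A]
  | d'.+1 => fun A => \bigcup_(a in (A : {set sdV V d'.+1})) vsd_supp a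
  end.
Definition sd_supp d (t : {set sdV V d.+1}) : {set {set V}} := \bigcup_(a in t) vsd_supp a.

Lemma suppS d (A B : {set sdV V d}) : A \subset B -> supp A \subset supp B.
Proof.
move=> AB; apply/subsetP => i /bigcupP[a aA ia]; apply/bigcupP; exists a => //.
exact: (subsetP AB).
Qed.

Lemma sd_suppS d (A B : {set sdV V d.+1}) : A \subset B -> sd_supp A \subset sd_supp B.
Proof.
move=> AB; apply/subsetP => i /bigcupP[a aA ia]; apply/bigcupP; exists a => //.
exact: (subsetP AB).
Qed.

Lemma vsupp_sd_supp d (x : sdV V d.+1) i :
  (i \in vsupp x) = [exists A in vsd_supp x, i \in A].
Proof.
elim: d x => [|d IH] x.
  apply/bigcupP/existsP => [[a ax] | [A]] /=.
    by rewrite inE => /eqP ->; exists x; rewrite inE eqxx.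
  by rewrite inE => /andP[/eqP -> ix]; exists i; rewrite ?inE.
apply/bigcupP/existsP => [[a ax] | [A /andP[/bigcupP[a ax Aa] iA]]].
  rewrite IH => /existsP[A /andP[Aa iA]]; exists A; rewrite iA andbT.
  by apply/bigcupP; exists a.
by exists a => //; rewrite IH; apply/existsP; exists A; rewrite Aa.
Qed.

Lemma mem_supp_sd_supp d (t : {set sdV V d.+1}) A i : A \in sd_supp t -> i \in A -> i \in supp t.
Proof.
case/bigcupP => a ta Aa iA; apply/bigcupP; exists a => //.
by rewrite vsupp_sd_supp; apply/existsP; exists A; rewrite Aa.
Qed.

Lemma iter_sd_complex d : is_complex (iter_sd d (Delta n)).
Proof.
apply/complexP; case: d => [|d]; split=> [s | s t].
- by rewrite !inE => /andP[].
- by rewrite !inE !subsetT => _ ->.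
- by case/mem_sd.
- case/mem_sd => _ /subsetP sK ch t0 /subsetP ts; apply/mem_sd; split=> //.
    by apply/subsetP => A /ts/sK.
  by move=> A B /ts As /ts Bs; apply: ch.
Qed.

Lemma supp_top d (t : {set sdV V d.+1}) (A : {set sdV V d}) : A \in t ->
  (forall B : {set sdV V d}, B \in t -> B \subset A) -> supp t = supp A.
Proof.
move=> At Atop; apply/setP => i; apply/bigcupP/idP => [[B Bt iB] | iA]; last by exists A.
exact: (subsetP (suppS (Atop B Bt))).
Qed.

(** The supports of the elements of a chain are dominated by that of its top. *)
Lemma mem_iter_dDelta d (t : {set sdV V d}) :
  (t \in iter_sd d (dDelta n)) = (t \in iter_sd d (Delta n)) && (supp t != setT).
Proof.
elim: d t => [|d IH] t.
  rewrite /= inE in_set1 andbC; congr (_ && (_ != _)).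
  by apply/setP => i; apply/idP/bigcupP => [it | [j jt]]; [exists i|]; rewrite ?inE // => /eqP ->.
apply/mem_sd/andP => [[t0 /subsetP tK ch] | [/mem_sd[t0 /subsetP tK ch] tS]].
  have tD : t \in iter_sd d.+1 (Delta n).
    by apply/mem_sd; split=> //; apply/subsetP => A /tK; rewrite IH => /andP[].
  split=> //; have [A At Atop] := sd_top tD.
  by rewrite (supp_top At Atop); have := tK _ At; rewrite IH => /andP[].
split=> //; apply/subsetP => A At; rewrite IH tK //=.
apply: contraNneq tS => AT; rewrite eqEsubset subsetT -AT.
by apply/subsetP => i iA; apply/bigcupP; exists A.
Qed.

Lemma sd_supp_chain d (t : {set sdV V d.+1}) : t \in iter_sd d.+1 (Delta n) ->
  sd_supp t \in sd (Delta n).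
Proof.
elim: d t => [|d IH] t tD.
  suff -> : sd_supp t = t by [].
  by apply/setP => A; apply/bigcupP/idP => [[B Bt] | At];
    [rewrite inE => /eqP -> | exists A; rewrite ?inE].
have [A At Atop] := sd_top tD.
have AD : A \in iter_sd d.+1 (Delta n) by case/mem_sd: tD => _ /subsetP H _; apply: H.
suff -> : sd_supp t = sd_supp (A : {set sdV V d.+1}) by apply: IH.
apply/setP => i; apply/bigcupP/idP => [[B Bt iB] | iA]; last by exists A.
exact: (subsetP (sd_suppS (Atop B Bt))).
Qed.

Section Lift.
Variable phi : V -> {set V}.
Hypothesis phi_inj : injective phi.

(** A labelling phi of the vertices of a simplex of Sd(Delta_n) by those of
    Delta_n induces an embedding of Sd^d(Delta_n) into Sd^(d+1)(Delta_n). *)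
Fixpoint lift d : sdV V d -> sdV V d.+1 :=
  match d return sdV V d -> sdV V d.+1 with
  | 0 => phi
  | d'.+1 => fun A => [set lift a | a in (A : {set sdV V d'})]
  end.

Lemma lift_inj d : injective (@lift d).
Proof. by elim: d => [|d IH] //=; apply: imset_inj. Qed.

Lemma vsd_supp_lift d (x : sdV V d) : vsd_supp (lift x) = phi @: vsupp x.
Proof.
elim: d x => [|d IH] x; first by rewrite /= imset_set1.
apply/setP => A; apply/bigcupP/imsetP => [[_ /imsetP[a ax ->]] | [i /bigcupP[a ax ia] ->]].
  move=> Aa; have : A \in phi @: vsupp a by rewrite -IH.
  by case/imsetP => i ia ->; exists i => //; apply/bigcupP; exists a.
exists (lift a); first exact: imset_f.
by have : phi i \in phi @: vsupp a; [apply: imset_f | rewrite -IH].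
Qed.

Lemma sd_supp_lift d (t : {set sdV V d}) : sd_supp [set lift a | a in t] = phi @: supp t.
Proof. exact: (@vsd_supp_lift d.+1 t). Qed.

Lemma lift_sub d (A B : {set sdV V d}) :
  ([set lift a | a in A] \subset [set lift a | a in B]) = (A \subset B).
Proof.
apply/idP/idP => [/subsetP H | ]; last exact: imsetS.
by apply/subsetP => a aA; have := H _ (imset_f _ aA); rewrite mem_imset //; exact: lift_inj.
Qed.

Lemma lift_simplex d (t : {set sdV V d}) : phi @: setT \in sd (Delta n) ->
  t \in iter_sd d (Delta n) -> [set lift a | a in t] \in iter_sd d.+1 (Delta n).
Proof.
move=> phiD; elim: d t => [|d IH] t.
  move=> tD; apply: sub_sd_Delta phiD _ _; first by apply: imsetS; apply: subsetT.
  by rewrite imset_eq0; move: tD; rewrite inE => /andP[].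
case/mem_sd => t0 /subsetP tK ch; apply/mem_sd; split; first by rewrite imset_eq0.
  by apply/subsetP => _ /imsetP[A /tK At ->]; apply: IH.
move=> _ _ /imsetP[A At ->] /imsetP[B Bt ->] /=.
by rewrite !lift_sub; apply: ch.
Qed.

(** The part of Sd^(d+1)(Delta_n) inside an n-simplex of Sd(Delta_n) is the
    image of the embedding. *)
Lemma lift_onto d (t : {set sdV V d.+1}) : t \in iter_sd d.+1 (Delta n) ->
  sd_supp t \subset phi @: setT ->
  exists2 t0 : {set sdV V d}, t0 \in iter_sd d (Delta n) & t = [set lift a | a in t0].
Proof.
elim: d t => [|d IH] t tD tphi.
  have tE : t = phi @: (phi @^-1: t).
    apply/setP => A; apply/idP/imsetP => [At | [i]]; last by rewrite inE => it ->.
    have /imsetP[i _ AE] : A \in phi @: setT.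
      by apply: (subsetP tphi); apply/bigcupP; exists A; rewrite ?inE.
    by exists i; rewrite ?inE -?AE.
  exists (phi @^-1: t) => //; rewrite !inE subsetT andbT.
  by case/mem_sd: tD => t0 _ _; apply: contraNneq t0 => e; rewrite tE e imset0.
have [t0 /subsetP tK ch] := mem_sd _ _ tD.
pose u : {set sdV V d.+1} := [set A0 in iter_sd d (Delta n) | lift (A0 : sdV V d.+1) \in t].
have tE : t = [set lift a | a in u].
  apply/setP => A; apply/idP/imsetP => [At | [A0]]; last by rewrite inE => /andP[_ H] ->.
  have [|A0 A0D AE] := IH A (tK _ At).
    apply: subset_trans tphi; apply/subsetP => B BA.
    by apply/bigcupP; exists A.
  by exists A0 => //; rewrite inE A0D /= -AE.
exists u => //; apply/mem_sd; split.
- by apply: contraNneq t0 => e; rewrite tE e imset0.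
- by apply/subsetP => A; rewrite inE => /andP[].
- move=> A B; rewrite !inE => /andP[_ At] /andP[_ Bt].
  by have := ch _ _ At Bt; rewrite /= !lift_sub.
Qed.

End Lift.

(** A tile with t removed facets is labelled in such a way that the vertices
    opposite to these facets get the labels 0, .., t - 1, as in T_t. *)
Lemma labelling (W : finType) (c R : {set W}) : R \subset c -> #|c| = n.+1 ->
  exists phi : V -> W, [/\ injective phi, phi @: setT = c &
    forall a, a \in R -> exists2 i : V, i < #|R| & phi i = a].
Proof.
move=> Rc cc; have /card_gt0P[a0 _] : 0 < #|c| by rewrite cc.
pose l := enum R ++ enum (c :\: R).
have lu : uniq l.
  rewrite cat_uniq !enum_uniq andbT /=; apply/hasPn => a.
  by rewrite !mem_enum inE => /andP[].
have lm : l =i c.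
  move=> a; rewrite mem_cat !mem_enum inE.
  by have [aR|] //= := boolP (a \in R); rewrite (subsetP Rc).
have ls : size l = n.+1 by rewrite -cc -(card_uniqP lu); apply: eq_card.
exists (fun i : V => nth a0 l i); split.
- move=> i j /eqP; rewrite nth_uniq ?ls // => /eqP; exact: val_inj.
- apply/setP => a; rewrite -lm; apply/imsetP/idP => [[i _ ->] | al].
    by rewrite mem_nth ?ls.
  have il : index a l < n.+1 by rewrite -ls index_mem.
  by exists (Ordinal il); rewrite ?nth_index.
- move=> a aR; have al : a \in l by rewrite lm (subsetP Rc).
  have il : index a l < n.+1 by rewrite -ls index_mem.
  exists (Ordinal il); rewrite ?nth_index //= index_cat mem_enum aR cardE index_mem.
  by rewrite mem_enum.
Qed.

(** A simplex belongs to the subdivision of T_s when its support contains the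
    vertices opposite to the removed facets. The condition is imposed on faces
    with at least p vertices only; for s = n + 1 this is the condition of a
    packing on the intersections with the boundary. *)
Definition admissible p d (s : nat) (F : {set {set sdV V d}}) : Prop :=
  [/\ F \subset iter_sd d (Delta n), {in F, forall t : {set _}, p <= #|t|},
      {in F &, forall t u : {set _}, t != u -> #|t :&: u| < p} &
      {in F, forall t u : {set sdV V d}, u \subset t -> p <= #|u| ->
         forall i : V, i < s -> i \in supp u}].

Lemma admissible_set0 p d s : admissible p s (set0 : {set {set sdV V d}}).
Proof.
split; first exact: sub0set.
- by move=> t; rewrite inE.
- by move=> t u; rewrite inE.
- by move=> t; rewrite inE.
Qed.

Lemma lift_tile p d (x : tile) (G : {set {set sdV V d}}) : 0 < p -> is_tile x ->
  admissible p #|x.2| G ->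
  exists G' : {set {set sdV V d.+1}}, [/\ admissible p 0 G',
    {in G', forall t u : {set sdV V d.+1}, u \subset t -> p <= #|u| ->
       sd_supp u \in tile_support x} &
    weight p G' = weight p G].
Proof.
move=> p0 /andP[]; rewrite inE => /andP[xD /eqP cx] /tile_decomp[R [Rc xE cR]] [GD Gp Gi Gs].
have [phi [phi_inj phiT phiR]] := labelling Rc cx.
pose lf (t : {set sdV V d}) := [set lift phi a | a in t].
have lfi : injective lf by apply: imset_inj; apply: lift_inj.
exists [set lf t | t in G]; split.
- split.
  + apply/subsetP => _ /imsetP[t tG ->]; apply: lift_simplex => //; first by rewrite phiT.
    exact: (subsetP GD).
  + by move=> _ /imsetP[t tG ->]; rewrite card_imset ?Gp //; exact: lift_inj.
  + move=> _ _ /imsetP[t tG ->] /imsetP[u uG ->] ne.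
    rewrite -imsetI; last by move=> ? ? _ _; apply: lift_inj.
    rewrite card_imset ?Gi //; first by apply: contraNneq ne => ->.
    exact: lift_inj.
  + by [].
- move=> _ /imsetP[t tG ->] u ut pu.
  have [u0 u0t uE] : exists2 u0 : {set sdV V d}, u0 \subset t & u = lf u0.
    exists [set a in t | lift phi a \in u].
      by apply/subsetP => a; rewrite inE => /andP[].
    apply/setP => b; apply/idP/imsetP => [bu | [a]]; last by rewrite inE => /andP[_ H ->].
    have /imsetP[a ta bE] := subsetP ut _ bu.
    by exists a => //; rewrite inE ta -bE.
  have pu0 : p <= #|u0| by move: pu; rewrite uE card_imset //; exact: lift_inj.
  rewrite uE sd_supp_lift xE mem_tile_support; apply/and3P; split.
  + have [a au0] : exists a, a \in u0 by apply/card_gt0P; apply: leq_trans pu0.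
    have aD : u0 \in iter_sd d (Delta n).
      have /complexP[_ H] := iter_sd_complex d.
      by apply: (H t) => //; [apply: (subsetP GD) | apply/set0Pn; exists a].
    rewrite imset_eq0; have := sd_supp_chain (lift_simplex phi_inj _ aD).
    rewrite phiT => /(_ xD); rewrite sd_supp_lift => /sd_DeltaP[+ _ _].
    by rewrite imset_eq0.
  + by rewrite -phiT; apply/imsetS/subsetT.
  + apply/subsetP => A /phiR[i iR <-]; apply/imset_f.
    by apply: (Gs t tG u0 u0t pu0); rewrite -cR.
- rewrite /weight big_imset /=; last by move=> ? ? _ _; apply: lfi.
  by apply: eq_bigr => t _; rewrite card_imset //; exact: lift_inj.
Qed.

(** The supports in Sd(Delta_n) of the simplices with at least p vertices lie in
    the tile of their copy. Distinct tiles being disjoint, such a simplex occurs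
    in one copy only, and it stays in T_s because its tile does. *)
Lemma admissible_assemble p d s (T : {set tile}) (G : nat -> {set {set sdV V d}}) : 0 < p ->
  {in T, forall x : tile, is_tile x} ->
  {in T, forall x : tile, tile_support x \subset sdT n s} ->
  {in T &, forall (x y : tile) t, t \in tile_support x -> t \in tile_support y -> x = y} ->
  {in T, forall x : tile, admissible p #|x.2| (G #|x.2|)} ->
  exists2 F : {set {set sdV V d.+1}}, admissible p s F &
    weight p F = \sum_(x in T) weight p (G #|x.2|).
Proof.
move=> p0 Tt Ts Td TG.
have H (x : tile) : exists G' : {set {set sdV V d.+1}}, if x \in T then [/\ admissible p 0 G',
    {in G', forall t u : {set sdV V d.+1}, u \subset t -> p <= #|u| ->
       sd_supp u \in tile_support x} &
    weight p G' = weight p (G #|x.2|)] else G' = set0.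
  have [xT|_] := boolP (x \in T); last by exists set0.
  exact: lift_tile p0 (Tt x xT) (TG x xT).
have [g Hg] := fin_all_exists H.
have gT x t : t \in g x -> x \in T.
  by have := Hg x; case: ifP => // _ ->; rewrite inE.
have gA x : x \in T -> admissible p 0 (g x) by move=> xT; have := Hg x; rewrite xT => -[].
have gC x t (u : {set sdV V d.+1}) :
    t \in g x -> u \subset t -> p <= #|u| -> sd_supp u \in tile_support x.
  by move=> tg; have := Hg x; rewrite (gT _ _ tg) => -[_ C _]; apply: C tg _.
have gdis x y t u (v : {set sdV V d.+1}) :
    t \in g x -> u \in g y -> v \subset t -> v \subset u -> p <= #|v| -> x = y.
  move=> tx uy vt vu pv; apply: (Td _ _ (gT _ _ tx) (gT _ _ uy) (sd_supp v)).
    exact: gC tx _ _.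
  exact: gC uy _ _.
have gp x t : t \in g x -> p <= #|t|.
  by move=> tg; have [_ H1 _ _] := gA _ (gT _ _ tg); apply: H1.
exists (\bigcup_x g x); first split.
- apply/bigcupsP => x _; apply/subsetP => t tg.
  by have [/subsetP H1 _ _ _] := gA _ (gT _ _ tg); apply: H1.
- by move=> t /bigcupP[x _ /gp].
- move=> t u /bigcupP[x _ tx] /bigcupP[y _ uy] ne; rewrite ltnNge; apply/negP => pv.
  have xy : x = y by apply: (gdis _ _ t u (t :&: u)); rewrite // ?subsetIl ?subsetIr.
  rewrite -xy in uy; have [_ _ H1 _] := gA _ (gT _ _ tx).
  by have := H1 _ _ tx uy ne; rewrite ltnNge pv.
- move=> t /bigcupP[x _ tx] u ut pu i is_.
  have := gC _ _ _ tx ut pu; move/(subsetP (Ts _ (gT _ _ tx))).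
  by case/mem_sdT => _ /(_ i is_)[A]; apply: mem_supp_sd_supp.
rewrite /weight partition_disjoint_bigcup => [|x y xy]; last first.
  rewrite -setI_eq0; apply: contraNT xy => /set0Pn[t]; rewrite inE => /andP[tx ty].
  by apply/eqP; apply: gdis tx ty (subxx t) (subxx t) (gp _ _ tx).
rewrite [RHS]big_mkcond; apply: eq_bigr => x _.
by have := Hg x; case: ifP => [_ [_ _] // | _ ->]; rewrite big_set0.
Qed.

Lemma tile_of_flag c : c \in flags n -> is_tile (c, facets c) /\ #|facets c| = n.+1.
Proof.
move=> cf; split; first by rewrite /is_tile cf subxx.
rewrite card_in_imset; last exact: setD1_inj.
by move: cf; rewrite inE => /andP[_ /eqP].
Qed.

(** The n-simplices of Sd(Delta_n) deprived of all their facets are pairwise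
    disjoint, and there are (n+1)! of them. *)
Lemma admissible_next p d (G : {set {set sdV V d}}) : 0 < p -> admissible p n.+1 G ->
  exists2 F : {set {set sdV V d.+1}}, admissible p n.+1 F & weight p F = n.+1`! * weight p G.
Proof.
move=> p0 HG; pose T : {set tile} := [set (c, facets c) | c in flags n].
have Tsupp (c : {set {set V}}) t : c \in flags n -> t \in tile_support (c, facets c) -> t = c.
  move=> cf; have -> : facets c = [set c :\ a | a in c] by [].
  rewrite mem_tile_support => /and3P[_ tc ct]; apply/eqP.
  by rewrite eqEsubset tc.
have [||||F HF wF] := @admissible_assemble p d n.+1 T (fun=> G) p0.
- by move=> _ /imsetP[c cf ->]; have [] := tile_of_flag cf.
- move=> _ /imsetP[c cf ->]; apply/subsetP => t /(Tsupp _ _ cf) ->.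
  exact: flag_sdT.
- by move=> _ _ /imsetP[b bf ->] /imsetP[c cf ->] t /(Tsupp _ _ bf) <- /(Tsupp _ _ cf) <-.
- by move=> _ /imsetP[c cf ->]; have [_ /= ->] := tile_of_flag cf.
exists F => //; rewrite wF sum_nat_const; congr (_ * _).
by rewrite card_imset ?card_flags // => b c [].
Qed.

(** Sd^(d+1)(Delta_n) is covered by (n+1)! copies of Sd^d(Delta_n). *)
Lemma card_iter_sd d : #|iter_sd d (Delta n)| <= n.+1`! ^ d * 2 ^ n.+1.
Proof.
elim: d => [|d IH].
  have := card_powerset [set: V]; rewrite cardsT card_ord expn0 mul1n => <-.
  by apply: subset_leq_card; apply/subsetP => t _; rewrite powersetE subsetT.
rewrite expnS -mulnA; apply: leq_trans (leq_mul (leqnn _) IH).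
rewrite -card_flags -sum_nat_const.
have H (c : {set {set V}}) : exists phi : V -> {set V}, c \in flags n ->
    injective phi /\ phi @: setT = c.
  have [|] := boolP (c \in flags n); last by exists (fun=> set0).
  rewrite inE => /andP[_ /eqP cc].
  have [phi [pi pT _]] := labelling (sub0set c) cc.
  by exists phi.
have [phi Hphi] := fin_all_exists H.
pose im c := [set [set lift (phi c) a | a in (t : {set sdV V d})] | t in iter_sd d (Delta n)].
apply: (@leq_trans (\sum_(c in flags n) #|im c|)); last first.
  by apply: leq_sum => c _; apply: leq_imset_card.
apply: (@leq_trans #|\bigcup_(c in flags n) im c|); last first.
  apply: (big_ind2 (fun (A : {set _}) k => #|A| <= k)) => [|A k B l Ak Bl|//].
    by rewrite cards0.
  by apply: leq_trans (leq_add Ak Bl); rewrite leq_card_setU.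
apply: subset_leq_card; apply/subsetP => t tD.
have [c cf tc] := chain_flag (sd_supp_chain tD).
have [pi pT] := Hphi c cf.
have [|t0 t0D tE] := lift_onto pi tD; first by rewrite pT.
by apply/bigcupP; exists c => //; apply/imsetP; exists t0.
Qed.

End Levels.

(** * Packing the first subdivision of a tile *)

Lemma card_outer m a b : b <= m -> #|[set x : 'I_m | (x < a) || (b <= x)]| = m - (b - a).
Proof.
move=> bm; set A := [set x | _].
have <- : #|~: A| = b - a.
  have -> : ~: A = [set x : 'I_m | x < b] :\: [set x : 'I_m | x < minn a b].
    by apply/setP => x; rewrite !inE; lia.
  rewrite cardsD (setIidPr _) ?card_ord_lt //; try lia.
  by apply/subsetP => x; rewrite !inE; lia.
by have := cardsC A; rewrite card_ord; lia.
Qed.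

Section FirstSubdivision.
Variables (n p s : nat).
Local Notation V := 'I_n.+1.
Hypotheses (p_gt0 : 0 < p) (pn : p <= n) (sn : s <= n).
Implicit Types (U A : {set V}) (x y : V).

(** The element of index x of the flag of the unimodal permutation that lists U
    increasingly, then the last vertex, then the complement of U decreasingly.
    For x in U it is an initial segment of U, and otherwise it is the complement
    of an initial segment of the complement of U. *)
Definition word_face U x : {set V} :=
  if x \in U then [set y in U | y <= x] else [set y | (y \in U) || (x <= y)].
Definition tail_in U (m : nat) : bool := [forall y : V, (m <= y < n) ==> (y \in U)].
(** The faces of index at most p - 2 are common to many words and are kept in
    any case. Those whose index belongs to the final run of U come from pairwise
    disjoint chains. The condition s <= x + 1 leaves, among the kept faces, at
    most p - 1 that do not contain the vertices 0, .., s - 1. *)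
Definition kept U : {set V} := [set x : V | (x.+1 < p) || ((s <= x.+1) && tail_in U x)].
Definition word_chain U : {set {set V}} := word_face U @: kept U.
Definition words : {set {set V}} :=
  [set U : {set V} | (ord_max \notin U) && [forall i : V, (i < s) ==> (i \in U)]].

Lemma wordsP U : reflect (ord_max \notin U /\ forall i : V, i < s -> i \in U) (U \in words).
Proof.
rewrite inE; apply: (iffP andP) => -[H1 H2]; split=> //.
  by move=> i is_; have /forallP/(_ i) := H2; rewrite is_.
by apply/forallP => i; apply/implyP; apply: H2.
Qed.

Lemma max_word_face U x : ord_max \notin U -> (ord_max \in word_face U x) = (x \notin U).
Proof.
move=> nU; rewrite /word_face; case: ifP => xU; rewrite !inE ?(negbTE nU) //=.
by rewrite -ltnS ltn_ord.
Qed.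

Lemma mem_word_face U x : x \in word_face U x.
Proof. by rewrite /word_face; case: ifP => xU; rewrite !inE ?xU leqnn ?orbT. Qed.

Lemma word_face_inj U : ord_max \notin U -> injective (word_face U).
Proof.
move=> nU x y e; have := max_word_face x nU; rewrite e max_word_face // => /negb_inj xy.
have hx : x \in word_face U y by rewrite -e mem_word_face.
have hy : y \in word_face U x by rewrite e mem_word_face.
move: hx hy; rewrite /word_face xy; case: ifP => yU; rewrite !inE xy yU /= => h1 h2.
  by apply: val_inj; apply/eqP; rewrite eqn_leq h1.
by apply: val_inj; apply/eqP; rewrite eqn_leq h1 h2.
Qed.

Lemma word_face_chain U x y :
  (word_face U x \subset word_face U y) || (word_face U y \subset word_face U x).
Proof.
rewrite /word_face; case: ifP => xU; case: ifP => yU; case/orP: (leq_total x y) => xy.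
all: apply/orP; try (by left; apply/subsetP => z; rewrite !inE; lia).
all: by right; apply/subsetP => z; rewrite !inE; lia.
Qed.

Lemma sub_word_face U x : x \notin U -> U \subset word_face U x.
Proof. by move=> xU; apply/subsetP => y yU; rewrite /word_face (negbTE xU) inE yU. Qed.

Lemma card_word_chain U : ord_max \notin U -> #|word_chain U| = #|kept U|.
Proof. by move=> nU; rewrite card_imset //; exact: word_face_inj. Qed.

Lemma tail_max U : tail_in U n.
Proof. by apply/forallP => y; apply/implyP; lia. Qed.

Lemma max_kept U : ord_max \in kept U.
Proof. by rewrite inE /= leqW // tail_max orbT. Qed.

Lemma card_low : #|[set x : V | x.+1 < p]| = p.-1.
Proof.
by rewrite -[RHS](@card_ord_lt n.+1); [apply: eq_card => x; rewrite !inE; lia | lia].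
Qed.

Lemma leq_card_kept U : p <= #|kept U|.
Proof.
have -> : p = #|ord_max |: [set x : V | x.+1 < p]|.
  rewrite cardsU1 card_low inE /=; have -> : (n.+1 < p) = false by lia.
  by rewrite /= add1n prednK.
apply: subset_leq_card; rewrite subUset sub1set max_kept.
by apply/subsetP => x; rewrite !inE => ->.
Qed.

(** If x' were larger than q, the common face would have to contain q as
    computed from U and to avoid q as computed from U'. *)
Lemma word_face_first U U' x x' q : ord_max \notin U -> ord_max \notin U' ->
  q \in U -> q \notin U' -> word_face U x = word_face U' x' -> x' <= q.
Proof.
move=> nU nU' qU qU' e; rewrite leqNgt; apply/negP => qx'.
have := max_word_face x nU; rewrite e max_word_face // => /negb_inj xx'.
have [x'U'|x'U'] := boolP (x' \in U').
  have xU : x \in U by rewrite -xx'.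
  have xx : x' <= x.
    by have := mem_word_face U' x'; rewrite -e /word_face xU inE => /andP[].
  have : q \in word_face U x by rewrite /word_face xU inE qU (leq_trans (ltnW qx')).
  by rewrite e /word_face x'U' inE (negbTE qU').
have xU : x \notin U by rewrite -xx'.
have : q \in word_face U x by apply: (subsetP (sub_word_face xU)).
by rewrite e /word_face (negbTE x'U') inE (negbTE qU') /= leqNgt qx'.
Qed.

(** By [word_face_first] a common face has an index at most q in U'. It cannot be
    kept because of the final run of U', as q is not in U'; so its index is at
    most p - 2, which leaves p - 1 faces. *)
Lemma word_chain_inter U U' : U \in words -> U' \in words -> U != U' ->
  #|word_chain U :&: word_chain U'| < p.
Proof.
wlog [q qU qU'] : U U' / exists2 q, q \in U & q \notin U'.
  move=> H UW UW' ne.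
  have [/subsetP UU'|/subsetPn[q qU qU']] := boolP (U \subset U'); last first.
    by apply: H => //; exists q.
  rewrite setIC; apply: H; rewrite 1?eq_sym //; apply/subsetPn.
  by apply: contra ne => U'U; rewrite eqEsubset U'U andbT; apply/subsetP.
move=> /wordsP[nU _] /wordsP[nU' _] _.
suff sub : word_chain U :&: word_chain U' \subset word_face U' @: [set x : V | x.+1 < p].
  have := subset_leq_card sub; rewrite card_imset ?card_low; last exact: word_face_inj.
  by move=> H; lia.
apply/subsetP => A; rewrite inE => /andP[/imsetP[x _ ->] /imsetP[x' x'i e]].
rewrite e; apply: imset_f; rewrite inE; move: x'i; rewrite inE => /orP[//|/andP[_ /forallP/(_ q)]].
rewrite (word_face_first nU nU' qU qU' e) (negbTE qU') implybF /= -leqNgt => nq.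
by case/negP: nU; suff <- : q = ord_max by []; apply: val_inj;
 apply/eqP; rewrite /= eqn_leq nq -ltnS ltn_ord.
Qed.

Lemma word_chain_sd U : word_chain U \in iter_sd 1 (Delta n).
Proof.
apply/sd_DeltaP; split.
- by apply/set0Pn; exists (word_face U ord_max); apply/imset_f/max_kept.
- by apply/negP => /imsetP[x _ /setP/(_ x)]; rewrite mem_word_face inE.
- by move=> _ _ /imsetP[x _ ->] /imsetP[y _ ->]; apply: word_face_chain.
Qed.

(** At most p - 1 of the kept faces do not contain the vertices 0, .., s - 1. *)
Lemma word_chain_supp U (u : {set sdV V 1}) : U \in words -> u \subset word_chain U -> p <= #|u| ->
  forall i : V, i < s -> i \in supp u.
Proof.
move=> /wordsP[nU sU] uU pu i is_.
have [/existsP[A /andP[Au iA]]|] := boolP [exists A in u, i \in A].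
  apply/bigcupP; exists A => //=; apply/bigcupP; exists i => //; exact: set11.
rewrite negb_exists => /forallP Hn.
suff sub : u \subset word_face U @: [set x : V | x.+1 < p].
  have := subset_leq_card sub; rewrite card_imset ?card_low; last exact: word_face_inj.
  by move=> H; lia.
apply/subsetP => A Au; have /imsetP[x xi AE] := subsetP uU A Au.
have := Hn A; rewrite Au AE /= => iA; apply: imset_f; rewrite inE.
move: xi; rewrite inE => /orP[//|/andP[sx _]]; case/negP: iA.
have iU := sU i is_.
have [xU|xU] := boolP (x \in U); last exact: (subsetP (sub_word_face xU)).
by rewrite /word_face xU inE iU /=; lia.
Qed.

Definition word_chains : {set {set sdV V 1}} := word_chain @: words.

Lemma word_chains_admissible : admissible p s word_chains.
Proof.
split.
- by apply/subsetP => _ /imsetP[U _ ->]; apply: word_chain_sd.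
- by move=> _ /imsetP[U /wordsP[nU _] ->]; rewrite card_word_chain ?leq_card_kept.
- move=> _ _ /imsetP[U UW ->] /imsetP[U' UW' ->] ne; apply: word_chain_inter => //.
  by apply: contraNneq ne => ->.
- by move=> _ /imsetP[U UW ->] u; apply: word_chain_supp.
Qed.

Lemma weight_word_chains : weight p word_chains = \sum_(U in words) 'C(#|kept U|.-1, p.+1).
Proof.
rewrite /weight big_imset /=; last first.
  move=> U U' UW UW' e; apply/eqP; apply: contraT => /(word_chain_inter UW UW').
  rewrite e setIid ltnNge card_word_chain ?leq_card_kept //.
  by case/wordsP: UW'.
by apply: eq_bigr => U /wordsP[nU _]; rewrite card_word_chain.
Qed.

Definition words_to m : {set {set V}} := [set U in words | tail_in U m].
Definition word0 : {set V} := [set x : V | x < n].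

Lemma tail_word0 m : tail_in word0 m.
Proof. by apply/forallP => y; apply/implyP; rewrite inE => /andP[]. Qed.

Lemma words_s : words_to s = [set word0].
Proof.
apply/setP => U; rewrite inE in_set1; apply/andP/eqP => [[/wordsP[nU sU] /forallP tU] | ->].
  apply/setP => x; rewrite inE; have := tU x; have := sU x.
  case: (ltngtP x n) => [xn||xn]; last first.
  - by move=> _ _; have -> : x = ord_max by [apply: val_inj]; apply/negbTE.
  - by have := ltn_ord x; lia.
  by case: (ltnP x s) => [xs /(_ isT) -> // | _ _ /= ->].
split; last exact: tail_word0.
by apply/wordsP; rewrite !inE ltnn; split=> // i is_; rewrite inE (leq_trans is_).
Qed.

Lemma tail_recl U (m : V) : m < n -> tail_in U m = (m \in U) && tail_in U m.+1.
Proof.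
move=> mn; apply/forallP/andP => [H | [mU /forallP H] y].
  split; first by have := H m; rewrite leqnn mn.
  apply/forallP => y; apply/implyP => /andP[my yn]; have := H y.
  by rewrite yn (ltnW my).
apply/implyP => /andP[]; rewrite leq_eqVlt => /orP[/eqP/val_inj <- // | my yn].
by have := H y; rewrite my yn.
Qed.

(** The words whose final run starts exactly at m + 1. *)
Definition words_new (m : V) : {set {set V}} := [set U in words_to m.+1 | m \notin U].

Lemma words_split (m : V) (G : {set V} -> nat) : m < n ->
  \sum_(U in words_to m.+1) G U = \sum_(U in words_to m) G U + \sum_(U in words_new m) G U.
Proof.
move=> mn; rewrite (bigID (fun U => m \in U)) /=; congr (_ + _); apply: eq_bigl => U.
  by rewrite !inE (tail_recl U mn) andbAC -!andbA.
by rewrite !inE.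
Qed.

Lemma card_words_new (m : V) : s <= m -> m < n -> #|words_new m| = #|words_to m|.
Proof.
move=> sm mn.
have -> : words_new m = [set U :\ m | U in words_to m].
  apply/setP => U; apply/idP/imsetP => [|[U' + ->]].
    rewrite in_set => /andP[]; rewrite in_set => /andP[/wordsP[nU sU] tU mU].
    exists (m |: U); last by rewrite setU1K.
    rewrite in_set (tail_recl _ mn) setU11; apply/andP; split.
      apply/wordsP; split; last by move=> i /sU iU; rewrite !inE iU orbT.
      by rewrite !inE (negbTE nU) orbF -val_eqE /= gtn_eqF.
    apply/forallP => y; apply/implyP => H; rewrite !inE.
    by have /forallP/(_ y) := tU; rewrite H /= => ->; rewrite orbT.
  rewrite in_set (tail_recl _ mn) => /andP[/wordsP[nU sU] /andP[mU tU]].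
  rewrite !in_set !inE eqxx andbT; apply/andP; split.
    rewrite (negbTE nU) andbF /=; apply/forallP => i; apply/implyP => is_.
    by rewrite !inE sU // andbT -val_eqE /= ltn_eqF // (leq_trans is_).
  apply/forallP => y; apply/implyP => /andP[my yn]; rewrite !inE.
  have /forallP/(_ y) := tU; rewrite my yn /= => ->.
  by rewrite andbT -val_eqE /= gtn_eqF.
rewrite card_in_imset // => U U'; rewrite !in_set !(tail_recl _ mn).
move=> /and3P[_ mU _] /and3P[_ mU' _] e.
by rewrite -(setD1K mU) -(setD1K mU') e.
Qed.

Lemma card_words_to m : s <= m <= n -> #|words_to m| = 2 ^ (m - s).
Proof.
elim: m => [|m IH] /andP[].
  by rewrite leqn0 => /eqP s0 _; rewrite -s0 words_s cards1 subnn.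
rewrite leq_eqVlt => /orP[/eqP <- _|sm mn]; first by rewrite words_s cards1 subnn.
have mn1 : m < n.+1 by lia.
have := words_split (fun=> 1) (mn : Ordinal mn1 < n).
rewrite !sum1_card card_words_new //= IH; last by lia.
by move=> ->; rewrite subSn // expnS; lia.
Qed.

Lemma card_kept_word0 : #|kept word0| = n.+1 - (s - p).
Proof.
have -> : s - p = s.-1 - p.-1 by lia.
rewrite -card_outer; last by lia.
by apply: eq_card => x; rewrite !inE tail_word0; lia.
Qed.

Lemma card_kept_new (m : V) U : s <= m -> m < n -> U \in words_new m ->
  #|kept U| = n.+1 - (m.+2 - p).
Proof.
move=> sm mn; rewrite in_set => /andP[]; rewrite in_set => /andP[UW tU] mU.
have -> : m.+2 - p = m.+1 - p.-1 by lia.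
rewrite -card_outer; last by lia.
apply: eq_card => x; rewrite !inE.
have -> : tail_in U x = (m < x).
  apply/idP/idP => [tx | mx].
    rewrite ltnNge; apply: contra mU => xm; have /forallP/(_ m) := tx.
    by rewrite xm mn.
  apply/forallP => y; apply/implyP => /andP[xy yn]; have /forallP/(_ y) := tU.
  by rewrite yn (leq_trans mx).
by have [mx|] := ltnP m x; rewrite ?andbF ?andbT; lia.
Qed.

(** The binomial C(dim, p + 1) of the chain of a word in [words_new m]. *)
Definition contrib (m : nat) : nat := 'C((n.+1 - (m.+2 - p)).-1, p.+1).

Lemma sum_words_to m : s <= m <= n ->
  \sum_(U in words_to m) 'C(#|kept U|.-1, p.+1) =
  'C((n.+1 - (s - p)).-1, p.+1) + \sum_(0 <= k < m) (s <= k) * 2 ^ (k - s) * contrib k.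
Proof.
have base : \sum_(U in words_to s) 'C(#|kept U|.-1, p.+1) =
  'C((n.+1 - (s - p)).-1, p.+1) + \sum_(0 <= k < s) (s <= k) * 2 ^ (k - s) * contrib k.
  rewrite words_s big_set1 card_kept_word0 big_nat big1 ?addn0 // => k /andP[_ ks].
  by rewrite leqNgt ks.
elim: m => [|m IH] /andP[].
  by rewrite leqn0 => /eqP s0 _; move: base; rewrite s0.
rewrite leq_eqVlt => /orP[/eqP e _|sm mn]; first by move: base; rewrite e.
have mn1 : m < n.+1 by lia.
rewrite (words_split _ (mn : Ordinal mn1 < n)) /= IH; last by lia.
rewrite big_nat_recr //= -addnA; congr (_ + (_ + _)).
rewrite (eq_bigr (fun=> contrib m)) => [|U UW]; last first.
  by rewrite (card_kept_new _ _ UW) //=; lia.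
rewrite sum_nat_const card_words_new //=.
rewrite card_words_to; last by lia.
have -> : s <= m by lia.
by rewrite mul1n.
Qed.

(** The coefficient of h_s in the bracket of the theorem. *)
Definition tile_weight : nat :=
  ((s == p) + (s < p) * 2 ^ (p.-1 - s)) * 'C(n, p.+1) +
  \sum_(p.+1 <= j < n.+2) ((s == j) + (s < j.-1) * 2 ^ (j - 2 - s)) * 'C(n + p - j, p.+1).

(** The word without gap gives the binomial of T_s itself. A word whose final run
    starts at m + 1 < p gives an n-simplex, and one whose final run starts at
    m + 1 >= p gives a simplex of dimension n + p - j with j = m + 2. *)
Lemma tile_weight_leq : tile_weight <= weight p word_chains.
Proof.
have -> : weight p word_chains = \sum_(U in words_to n) 'C(#|kept U|.-1, p.+1).
  by rewrite weight_word_chains; apply: eq_bigl => U; rewrite [in RHS]in_set tail_max andbT.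
rewrite sum_words_to ?sn ?leqnn // /tile_weight.
have p1n : p.-1 <= n by lia.
rewrite [X in _ <= _ + X](big_cat_nat (leq0n p.-1) p1n) /=.
under [X in _ + X <= _]eq_bigr do rewrite mulnDl.
rewrite big_split /= addnA [X in _ <= X]addnA.
have -> : \sum_(p.+1 <= j < n.+2) (s < j.-1) * 2 ^ (j - 2 - s) * 'C(n + p - j, p.+1) =
  \sum_(p.-1 <= k < n) (s <= k) * 2 ^ (k - s) * contrib k.
  have e1 : p.+1 = p.-1 + 2 by lia.
  rewrite [X in index_iota X n.+2]e1 big_addn.
  have -> : n.+2 - 2 = n by lia.
  apply: eq_big_nat => k /andP[pk kn]; rewrite /contrib.
  have -> : (k + 2).-1 = k.+1 by lia.
  have -> : k + 2 - 2 - s = k - s by lia.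
  rewrite ltnS; congr (_ * 'C(_, _)); lia.
rewrite leq_add2r.
have -> : \sum_(0 <= k < p.-1) (s <= k) * 2 ^ (k - s) * contrib k =
   \sum_(0 <= k < p.-1) (s <= k) * 2 ^ (k - s) * 'C(n, p.+1).
  apply: eq_big_nat => k /andP[_ kp]; rewrite /contrib; congr (_ * 'C(_, _)); lia.
have [ps|sp|sp] := ltngtP p s.
- rewrite mul0n add0n addnC.
  rewrite (big_cat_nat _ (n := s)) /=; [|lia|lia].
  rewrite big_nat big1 ?add0n; last by move=> j /andP[_ js]; rewrite gtn_eqF.
  rewrite big_ltn; last by lia.
  rewrite eqxx mul1n big_nat big1 ?addn0; last by move=> j /andP[sj _]; rewrite ltn_eqF.
  apply: leq_trans (leq_addr _ _); rewrite leq_eqVlt; apply/orP; left; apply/eqP.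
  congr 'C(_, _); lia.
- rewrite add0n mul1n [X in _ + X]big_nat [X in _ + X]big1 ?addn0; last first.
    by move=> j /andP[pj _]; rewrite ltn_eqF //; lia.
  have -> : (n.+1 - (s - p)).-1 = n by lia.
  rewrite -big_distrl /= -{2}['C(n, p.+1)]mul1n -mulnDl leq_mul2r; apply/orP; right.
  have : s <= p.-1 by lia.
  elim: p.-1 => [|q IH]; first by rewrite leqn0 => /eqP ->.
  rewrite leq_eqVlt => /orP[/eqP <-|sq]; first by rewrite subnn.
  have sq' : s <= q := sq.
  rewrite big_nat_recr //= sq' mul1n subSn // expnS.
  by have := IH sq'; lia.
- rewrite sp subnn mul1n [X in _ + X]big_nat [X in _ + X]big1 ?addn0; last first.
    by move=> j /andP[pj _]; rewrite ltn_eqF //; lia.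
  by rewrite subn0 leq_addr.
Qed.

End FirstSubdivision.

(** * Admissible families and the sequence of maxima *)

Section PackingValue.
Variables (R : realFieldType) (n p : nat) (nu : R).
Local Notation V := 'I_n.+1.
Hypothesis p_gt0 : 0 < p.
Local Open Scope ring_scope.

Definition weight_factor : R := nu * (1 - nu) * (nu ^+ p + (1 - nu) ^+ p).

Lemma weight_factor_ge0 : 0 <= nu <= 1 -> 0 <= weight_factor.
Proof.
move=> /andP[nu0 nu1]; have nu1' : 0 <= 1 - nu by rewrite subr_ge0.
by rewrite !mulr_ge0 // addr_ge0 // exprn_ge0.
Qed.

(** The packing is the complex of the faces of the members of F. *)
Lemma packing_of_admissible d (F : {set {set sdV V d}}) : admissible p n.+1 F ->
  exists2 L, L \in packing d n p & Mfun p nu L = weight_factor * (weight p F)%:R.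
Proof.
move=> [FD Fp Fi Fs].
have /complexP[Dn0 Ddn] := iter_sd_complex n d.
pose L := [set t : {set sdV V d} | (t != set0) && [exists s in F, t \subset s]].
have LC : is_complex L.
  apply/complexP; split=> [s | s t]; rewrite !inE; first by case/andP.
  move=> /andP[_ /existsP[u /andP[uF su]]] t0 ts; rewrite t0 /=.
  by apply/existsP; exists u; rewrite uF (subset_trans ts).
have FL : F \subset L.
  apply/subsetP => s sF; rewrite inE -card_gt0 (leq_trans p_gt0 (Fp _ sF)) /=.
  by apply/existsP; exists s; rewrite sF subxx.
have LF t : t \in L -> exists2 s, s \in F & t \subset s.
  by rewrite inE => /andP[_ /existsP[s /andP[? ?]]]; exists s.
exists L; last by apply: Mfun_packed.
rewrite inE; apply/andP; split.
  rewrite /subcomplex LC; apply/subsetP => t tL; have [s sF ts] := LF _ tL.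
  by move: tL; rewrite inE => /andP[t0 _]; apply: Ddn ts; rewrite // (subsetP FD).
apply/existsP; exists F; apply/and4P; split=> //.
- apply/forallP => t; apply/implyP => tL; have [s sF ts] := LF _ tL.
  by apply/existsP; exists s; rewrite sF.
- apply/forallP => s; apply/implyP => sF.
  apply/forallP => t; apply/implyP => tF; apply/implyP => ne.
  by rewrite /sdim ltrD2r ltz_nat; apply: Fi.
- apply/forallP => s; apply/implyP => sF; rewrite /cdim ltrD2r ltz_nat.
  rewrite -[p]prednK // ltnS; apply/bigmax_leqP => t; rewrite inE => /andP[].
  rewrite mem_iter_dDelta => /andP[tD tS] ts; rewrite -ltnS prednK // ltnNge.
  apply: contra tS => pt; rewrite eqEsubset subsetT; apply/subsetP => i _.
  exact: (Fs s sF t ts pt).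
Qed.

(** Members with fewer than p vertices are dropped: they have weight 0. *)
Lemma admissible_of_packing d L : L \in packing d n p ->
  exists F : {set {set sdV V d}}, [/\ admissible p n.+1 F,
    Mfun p nu L = weight_factor * (weight p F)%:R & (weight p F <= #|iter_sd d (Delta n)|)%N].
Proof.
rewrite inE => /andP[/andP[LC LD] /existsP[F /and4P[FL /'forall_implyP LF Fi Fb]]].
have /complexP[Dn0 Ddn] := iter_sd_complex n d.
have FLP : packed_by p L F.
  split=> //; first by move=> t /LF/existsP[s /andP[? ?]]; exists s.
  move=> s t sF tF ne; move/'forall_in_'forall_implyP: Fi => /(_ s sF t tF).
  by rewrite ne /sdim ltrD2r ltz_nat.
pose F' := [set s in F | (p <= #|s|)%N].
have wtE : weight p F' = weight p F.
  rewrite /weight [RHS](bigID (fun s : {set _} => p <= #|s|)%N) /= [X in (_ + X)%N]big1 ?addn0.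
    by apply: eq_bigl => s; rewrite inE.
  by move=> s /andP[_ sp]; apply: bin_small; lia.
exists F'; split; last 2 first.
- by rewrite wtE; apply: Mfun_packed.
- have wL := weight_leq_card FLP; rewrite wtE (leq_trans wL) //.
  exact: subset_leq_card.
split.
- by apply: subset_trans LD; apply: subset_trans FL; apply/subsetP => s; rewrite inE => /andP[].
- by move=> s; rewrite inE => /andP[].
- move=> s t; rewrite !inE => /andP[sF _] /andP[tF _]; case: FLP => _ _ _; exact.
move=> s; rewrite inE => /andP[sF _] u us pu i _.
have uD : u \in iter_sd d (Delta n).
  apply: (Ddn s) => //; first by apply: (subsetP LD); apply: (subsetP FL).
  by rewrite -card_gt0 (leq_trans p_gt0).
suff /eqP -> : supp u == setT by rewrite inE.
apply: contraLR pu => uT; rewrite -ltnNge.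
move/'forall_implyP: Fb => /(_ s sF); rewrite /cdim ltrD2r ltz_nat.
apply: leq_ltn_trans; apply: (@leq_bigmax_cond _ _ (fun t : {set _} => #|t|)).
by rewrite inE mem_iter_dDelta uD uT.
Qed.

Lemma Mfun_set0 (W : finType) : Mfun p nu (set0 : {set {set W}}) = 0.
Proof.
have H : packed_by p (set0 : {set {set W}}) set0.
  split; rewrite ?sub0set //; last by move=> ? ?; rewrite inE.
    by apply/complexP; split=> [s|s t]; rewrite inE.
  by move=> t; rewrite inE.
by rewrite (Mfun_packed p_gt0 H) /weight big_set0 mulr0.
Qed.

Hypothesis nu01 : 0 <= nu <= 1.

Lemma fact_pow_gt0 d : 0 < (n.+1)`!%:R ^+ d :> R.
Proof. by rewrite exprn_gt0 // ltr0n fact_gt0. Qed.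

Lemma lambda_seq_ge d (F : {set {set sdV V d}}) : admissible p n.+1 F ->
  weight_factor * (weight p F)%:R / (n.+1)`!%:R ^+ d <= lambda_seq n p nu d.
Proof.
move=> /packing_of_admissible[L LP <-].
by rewrite mulrC ler_wpM2l ?invr_ge0 ?(ltW (fact_pow_gt0 _)) // le_bigmax_cond.
Qed.

Lemma lambda_seq_leP d x : 0 <= x ->
  (forall F : {set {set sdV V d}}, admissible p n.+1 F ->
     (weight p F <= #|iter_sd d (Delta n)|)%N ->
     weight_factor * (weight p F)%:R / (n.+1)`!%:R ^+ d <= x) ->
  lambda_seq n p nu d <= x.
Proof.
move=> x0 H; rewrite /lambda_seq mulrC ler_pdivrMr ?fact_pow_gt0 //.
apply: bigmax_le => [|L /admissible_of_packing[F [HF -> wF]]].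
  by rewrite Mfun_set0 mulr_ge0 // ltW // fact_pow_gt0.
by rewrite -ler_pdivrMr ?fact_pow_gt0 //; apply: H.
Qed.

Lemma lambda_seq_ge0 d : 0 <= lambda_seq n p nu d.
Proof.
by have := lambda_seq_ge (admissible_set0 n p d n.+1); rewrite /weight big_set0 mulr0 mul0r.
Qed.

Lemma lambda_seq_nondecr d : lambda_seq n p nu d <= lambda_seq n p nu d.+1.
Proof.
apply: lambda_seq_leP => [|F HF _]; first exact: lambda_seq_ge0.
have [G HG wG] := admissible_next p_gt0 HF.
apply: le_trans (lambda_seq_ge HG); rewrite wG natrM exprS.
rewrite le_eqVlt; apply/orP; left; apply/eqP.
have N0 : (n.+1)`!%:R != 0 :> R by rewrite pnatr_eq0 -lt0n fact_gt0.
by move: (_`!%:R) N0 => b b0; field; rewrite expf_neq0.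
Qed.

Lemma lambda_seq_bounded d : lambda_seq n p nu d <= weight_factor * (2 ^ n.+1)%:R.
Proof.
have c0 := weight_factor_ge0 nu01.
apply: lambda_seq_leP => [|F _ wF]; first by rewrite mulr_ge0.
rewrite ler_pdivrMr ?fact_pow_gt0 //.
move: weight_factor c0 => c c0; rewrite -mulrA ler_wpM2l // mulrC -natrX -natrM ler_nat.
by apply: leq_trans wF _; rewrite card_iter_sd.
Qed.

End PackingValue.

(** * Iterating the matrix of h-vectors *)

Section Iteration.
Variables (n p : nat).
Local Notation V := 'I_n.+1.
Hypotheses (p_gt0 : 0 < p) (pn : p <= n).

(** The entries of H^k w for the vector w of the [tile_weight]. *)
Fixpoint iter_weight k (s : nat) : nat :=
  if k is k'.+1 then \sum_(x in the_tiling n s) iter_weight k' #|x.2| else tile_weight n p s.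

Lemma tile_weight_last : tile_weight n p n.+1 = 0.
Proof.
rewrite /tile_weight gtn_eqF // [n.+1 < p]ltnNge (leqW pn) mul0n add0n.
rewrite big_nat big1 // => j /andP[pj jn].
have [<-|/negbTE nj] := eqVneq n.+1 j; first by rewrite bin_small ?muln0 //; lia.
have -> : (n.+1 < j.-1) = false by lia.
by [].
Qed.

Lemma iter_weight_admissible k s : s <= n.+1 ->
  exists2 F : {set {set sdV V k.+1}}, admissible p s F & iter_weight k s <= weight p F.
Proof.
elim: k s => [|k IH] s sn.
  have [s'|s'] := leqP s n.
    by exists (word_chains n p s); [apply: word_chains_admissible | apply: tile_weight_leq].
  have -> : s = n.+1 by lia.
  by exists set0; [apply: admissible_set0 | rewrite /= tile_weight_last].
have H (t : 'I_n.+2) : exists F : {set {set sdV V k.+1}},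
    admissible p t F /\ iter_weight k t <= weight p F.
  by have [F ? ?] := IH t (ltn_ord t : t <= n.+1); exists F.
have [g Hg] := fin_all_exists H.
have [HT _] := the_tilingP sn.
have tile2 x : x \in the_tiling n s -> #|x.2| < n.+2.
  by move=> xT; apply: card_removed_lt; apply: tiling_tile HT xT.
have [||||F HF wF] := @admissible_assemble n p k.+1 s (the_tiling n s) (fun t => g (inord t)) p_gt0.
- by move=> x; apply: tiling_tile HT.
- by move=> x xT; case/and3P: HT => _ /'forall_implyP/(_ x xT).
- by move=> x y xT yT t; apply: tiling_uniq HT xT yT.
- by move=> x xT; have [] := Hg (inord #|x.2|); rewrite inordK // tile2.
exists F => //; rewrite wF; apply: leq_sum => x xT.
by have [] := Hg (inord #|x.2|); rewrite inordK // tile2.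
Qed.

Lemma iter_weightS k s : s <= n.+1 -> iter_weight k.+1 s =
  \sum_(t < n.+2) hcount (the_tiling n s) t * iter_weight k t.
Proof. by move=> /the_tilingP[HT _]; rewrite /= (sum_tiling _ HT). Qed.

Lemma sum_hcount s : s <= n.+1 -> \sum_(t < n.+2) hcount (the_tiling n s) t = n.+1`!.
Proof.
move=> /the_tilingP[HT _]; rewrite -(card_tiling HT) -sum1_card.
rewrite (sum_tiling (fun=> 1) HT); apply: eq_bigr => t _; exact: (esym (muln1 _)).
Qed.

(** A positive column of the matrix of h-vectors. *)
Lemma hcount1 s : s <= n.+1 -> 0 < hcount (the_tiling n s) 1.
Proof. by move=> /the_tilingP[HT h0]; apply: hcount1_gt0 HT h0; lia. Qed.

Section Real.
Variable R : realFieldType.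
Local Open Scope ring_scope.

(** Each combination gives weight at least 1 to the same entry v i; the remaining
    weights have the same sum N - 1 in all combinations. *)
Lemma average_bounds (N : nat) (c : 'I_n.+2 -> nat) (v : 'I_n.+2 -> R) (a b : R) (i : 'I_n.+2) :
  (0 < c i)%N -> (\sum_t c t)%N = N -> (forall t, b <= v t <= a) ->
  (N - 1)%:R * b + v i <= \sum_t (c t)%:R * v t <= (N - 1)%:R * a + v i.
Proof.
move=> ci cN vab.
have cE : (N - 1)%:R = (c i - 1)%:R + \sum_(t | t != i) (c t)%:R :> R.
  by rewrite -natr_sum -natrD -cN (bigD1 i) //=; congr (_%:R); lia.
have vE : (c i)%:R * v i = (c i - 1)%:R * v i + v i by rewrite natrB // mulrBl mul1r subrK.
rewrite (bigD1 i) //= vE cE !mulrDl !mulr_suml [_ + v i + _]addrAC.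
apply/andP; split; rewrite lerD2r ?lerD //.
- by rewrite ler_wpM2l //; case/andP: (vab i).
- by apply: ler_sum => t _; rewrite ler_wpM2l //; case/andP: (vab t).
- by rewrite ler_wpM2l //; case/andP: (vab i).
- by apply: ler_sum => t _; rewrite ler_wpM2l //; case/andP: (vab t).
Qed.

(** By [average_bounds] for the column T_1, one application of H replaces the
    bounds b and a of the entries by (N - 1) b + v and (N - 1) a + v for the
    same v. *)
Lemma iter_weight_osc : exists2 D : R, 0 <= D & forall k (s t : 'I_n.+2),
  `|(iter_weight k s)%:R - (iter_weight k t)%:R| <= (n.+1`! - 1)%:R ^+ k * D :> R.
Proof.
exists (\sum_(s < n.+2) (tile_weight n p s)%:R); first exact: sumr_ge0.
move=> k; suff [a [b [Hab abk]]] : exists a b : R,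
    (forall s : 'I_n.+2, b <= (iter_weight k s)%:R <= a) /\
    a - b <= (n.+1`! - 1)%:R ^+ k * \sum_(s < n.+2) (tile_weight n p s)%:R.
  move=> s t; apply: le_trans abk; rewrite ler_norml opprB.
  by have /andP[? ?] := Hab s; have /andP[? ?] := Hab t; rewrite !lerB.
elim: k => [|k [a [b [Hab abk]]]].
  exists (\sum_(s < n.+2) (tile_weight n p s)%:R), 0; split; last by rewrite subr0 mul1r.
  by move=> s; rewrite ler0n /= (bigD1 s) //= lerDl sumr_ge0.
pose one : 'I_n.+2 := inord 1.
have oneE : one = 1%N :> nat by rewrite inordK //; lia.
(* Column 1 of the matrix of h-vectors is positive. *)
exists ((n.+1`! - 1)%:R * a + (iter_weight k one)%:R),
  ((n.+1`! - 1)%:R * b + (iter_weight k one)%:R).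
split=> [s|]; last first.
  by rewrite opprD addrACA subrr addr0 -mulrBr exprS -mulrA ler_wpM2l.
have sn : (s <= n.+1)%N by rewrite -ltnS ltn_ord.
rewrite iter_weightS // natr_sum; under eq_bigr do rewrite natrM.
apply: (average_bounds (v := fun t : 'I_n.+2 => (iter_weight k t)%:R)) Hab => //.
  by rewrite oneE hcount1.
exact: sum_hcount.
Qed.

Lemma eigen_iter_weight (h : 'cV[R]_n.+2) k :
  (Hmx R n)^T *m h = n.+1`!%:R *: h ->
  \sum_s h s 0 * (iter_weight k s)%:R =
  n.+1`!%:R ^+ k * \sum_s h s 0 * (tile_weight n p s)%:R.
Proof.
move=> Hh; elim: k => [|k IH]; first by rewrite mul1r.
rewrite exprS -mulrA -IH mulr_sumr.
transitivity (\sum_s \sum_(t < n.+2)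
    (h s 0 * (hcount (the_tiling n s) t)%:R * (iter_weight k t)%:R)).
  apply: eq_bigr => s _; have sn : (s <= n.+1)%N by rewrite -ltnS ltn_ord.
  rewrite iter_weightS // natr_sum mulr_sumr.
  by apply: eq_bigr => t _; rewrite natrM mulrA.
rewrite exchange_big /=; apply: eq_bigr => t _; rewrite -mulr_suml mulrA; congr (_ * _).
have := congr1 (fun M : 'cV_ _ => M t 0) Hh; rewrite !mxE => <-.
by apply: eq_bigr => s _; rewrite !mxE mulrC.
Qed.

(** Pairing with h multiplies by N when H is applied, while all the entries of
    H^k w become relatively close to the last one. *)
Lemma eigen_weight_bound (h : 'cV[R]_n.+2) :
  (Hmx R n)^T *m h = n.+1`!%:R *: h -> \sum_s h s 0 = 1 ->
  exists2 C : R, 0 <= C & forall k,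
    \sum_s h s 0 * (tile_weight n p s)%:R <=
    (iter_weight k n.+1)%:R / n.+1`!%:R ^+ k + C * ((n.+1`! - 1)%:R / n.+1`!%:R) ^+ k.
Proof.
move=> Hh h1; have [D D0 HD] := iter_weight_osc.
exists (\sum_s `|h s 0| * D) => [|k]; first by apply: sumr_ge0 => s _; rewrite mulr_ge0.
have Nk0 : 0 < n.+1`!%:R ^+ k :> R by rewrite exprn_gt0 // ltr0n fact_gt0.
rewrite expr_div_n mulrA -mulrDl ler_pdivlMr // mulrC -eigen_iter_weight //.
rewrite -lerBlDl.
have -> : (iter_weight k n.+1)%:R = \sum_s h s 0 * (iter_weight k (ord_max : 'I_n.+2))%:R :> R.
  by rewrite -mulr_suml h1 mul1r.
rewrite -sumrB mulr_suml; apply: ler_sum => s _; rewrite -mulrBr.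
apply: le_trans (ler_norm _) _; rewrite normrM -mulrA ler_wpM2l // mulrC.
exact: HD.
Qed.

Lemma sum_indicator (H : nat -> R) (m a b e : nat) : (a < m)%N -> (b <= m)%N -> (b <= e.+1)%N ->
  \sum_(0 <= s < m) H s * ((s == a) + (s < b) * 2 ^ (e - s))%N%:R =
  H a + 2 ^+ e * \sum_(0 <= i < b) H i / 2 ^+ i.
Proof.
move=> am bm be.
under eq_bigr do rewrite natrD mulrDr; rewrite big_split /=; congr (_ + _).
  rewrite (bigD1_seq a) ?iota_uniq ?mem_index_iota //= eqxx mulr1 big1 ?addr0 //.
  by move=> i /negbTE ->; rewrite mulr0.
rewrite (big_cat_nat (leq0n b) bm) /= [X in _ + X]big_nat [X in _ + X]big1 ?addr0; last first.
  by move=> i /andP[bi _]; rewrite ltnNge bi mulr0.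
rewrite mulr_sumr; apply: eq_big_nat => i /andP[_ ib]; rewrite ib mul1n natrX.
have ie : (i <= e)%N by lia.
rewrite -[in RHS](subnK ie) exprD mulrCA; congr (_ * _).
by rewrite mulfK // expf_neq0 // pnatr_eq0.
Qed.

Lemma sum_tile_weight (H : nat -> R) :
  \sum_(0 <= s < n.+2) H s * (tile_weight n p s)%:R =
  (H p + 2 ^+ (p - 1) * \sum_(0 <= i < p) H i / 2 ^+ i) * 'C(n, p.+1)%:R
   + \sum_(p.+1 <= j < n.+2)
       (H j + 2 ^+ (j - 2) * \sum_(0 <= i < j - 1) H i / 2 ^+ i)
       * 'C(n + p - j, p.+1)%:R.
Proof.
under eq_bigr do rewrite natrD mulrDr natrM mulrA natr_sum mulr_sumr.
rewrite big_split /= -mulr_suml; congr (_ * _ + _).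
  by rewrite subn1; apply: sum_indicator; lia.
rewrite exchange_big /=; apply: eq_big_nat => j /andP[pj jn].
under eq_bigr do rewrite natrM mulrA.
by rewrite -mulr_suml subn1; congr (_ * _); apply: sum_indicator; lia.
Qed.

End Real.
End Iteration.

(** * Passage to the limit *)

From mathcomp Require Import all_classical all_reals all_analysis.
Import numFieldNormedType.Exports.
Local Open Scope ring_scope.

(** The sequence is nondecreasing and bounded, so it converges to its
    supremum. *)
Lemma lambda_seq_le_lambda (R : realType) (n p : nat) (nu : R) d : (0 < p)%N ->
  0 <= nu <= 1 -> lambda_seq n p nu d <= lambda n p nu.
Proof.
move=> p0 nu01; have mono : nondecreasing_seq (lambda_seq n p nu).
  by apply/nondecreasing_seqP => m; apply: lambda_seq_nondecr.
apply: nondecreasing_cvgn_le => //; apply: nondecreasing_is_cvgn => //.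
exists (weight_factor p nu * (2 ^ n.+1)%:R) => _ [m _ <-].
exact: lambda_seq_bounded.
Qed.

Lemma le_of_geometric_error (R : realType) (x l C q : R) : 0 <= q < 1 ->
  (forall k, x <= l + C * q ^+ k) -> x <= l.
Proof.
move=> /andP[q0 q1] H.
have cq : ((fun k => l + C * q ^+ k) @ \oo --> l + C * 0)%classic.
  apply: cvgD; first exact: cvg_cst.
  by apply: cvgM; [exact: cvg_cst | apply: cvg_expr; rewrite ger0_norm].
rewrite mulr0 addr0 in cq.
by apply: (ler_cvg_to (@cvg_cst _ x _ \oo%classic _) cq); apply: nearW.
Qed.

Theorem theorem1p13 (R : realType) (n p : nat) (nu : R)
    (hn : (2 <= n)%N) (hp : (1 <= p <= n.-1)%N) (hnu : 0 <= nu <= 1) :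
  nu * (1 - nu) * (nu ^+ p + (1 - nu) ^+ p) / (n.+1)`!%:R *
  ((hcoef R n p + 2 ^+ (p - 1) * \sum_(0 <= i < p) hcoef R n i / 2 ^+ i)
     * 'C(n, p.+1)%:R
   + \sum_(p.+1 <= j < n.+2)
       (hcoef R n j + 2 ^+ (j - 2) * \sum_(0 <= i < j - 1) hcoef R n i / 2 ^+ i)
       * 'C(n + p - j, p.+1)%:R)
  <= lambda n p nu.
Proof.
have p0 : (0 < p)%N by case/andP: hp.
have pn : (p <= n)%N by case/andP: hp => _ /leq_trans; apply; apply: leq_pred.
have c0 := weight_factor_ge0 p hnu; rewrite -/(weight_factor p nu).
rewrite -(sum_tile_weight p0 pn) big_mkord.
under eq_bigr do rewrite /hcoef inord_val.
have N0 : 0 < (n.+1)`!%:R :> R by rewrite ltr0n fact_gt0.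
rewrite /hvec; case: xgetP => [h _ [Hh h1] | _]; last first.
  (* The default value of h is the zero vector. *)
  rewrite big1 ?mulr0 => [|s _]; last by rewrite mxE mul0r.
  by apply: le_trans (lambda_seq_le_lambda n 0 p0 hnu); apply: lambda_seq_ge0.
have [C C0 HC] := eigen_weight_bound p0 pn Hh h1.
apply: (@le_of_geometric_error _ _ _ (weight_factor p nu / (n.+1)`!%:R * C)
          (((n.+1)`! - 1)%:R / (n.+1)`!%:R)) => [|k].
  by rewrite divr_ge0 //= ltr_pdivrMr // mul1r ltr_nat subn1 prednK ?fact_gt0.
have u0 : 0 <= weight_factor p nu / (n.+1)`!%:R by rewrite divr_ge0 // ltW.
apply: le_trans (ler_wpM2l u0 (HC k)) _.
rewrite mulrDr [leLHS]addrC mulrA [leLHS]addrC lerD2r.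
have [F HF wF] := iter_weight_admissible p0 pn k (leqnn n.+1).
apply: le_trans (lambda_seq_le_lambda n k.+1 p0 hnu).
apply: le_trans (lambda_seq_ge nu p0 HF).
rewrite mulf_div -exprS ler_pM2r ?invr_gt0 ?exprn_gt0 //.
by apply: ler_wpM2l; rewrite ?ler_nat.
Qed.
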